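(* Let $(\mathbf X_i)_{i\in\mathbb N}$ be a strictly stationary sequence of $d$-variate random vectors whose common distribution function $F$ has continuous margins $F_1,\dots,F_d$ and copula $C$. Suppose that: (a) the empirical process $\alpha_n=\sqrt n\,(G_n-C)$ converges weakly in $(\ell^\infty([0,1]^d),\|\cdot\|_\infty)$ to some limit process $\alpha$ which has continuous sample paths almost surely; (b) the set $\mathcal S$ of points in $[0,1]^d$ where the (first-order) partial derivatives $\dot C_1,\dots,\dot C_d$ of $C$ exist and are continuous has Lebesgue measure $1$. Then the empirical copula process $\mathbb C_n=\sqrt n\,(C_n-C)$ satisfies $$\mathbb C_n\rightsquigarrow \mathbb C=\alpha+\mathrm dC_{(-\alpha_1,\dots,-\alpha_d)},\qquad n\to\infty,$$ in $(L^\infty([0,1]^d),d_{\mathrm{hypi}})$, where, for $a=(a_1,\dots,a_d)\in\{\mathcal C([0,1])\}^d$ and $\mathbf u\in[0,1]^d$, $$\mathrm dC_a(\mathbf u)=\sup_{\varepsilon>0}\inf\Big\{\sum_{j=1}^d\dot C_j(\mathbf v)\,a_j(v_j):\ \mathbf v\in\mathcal S,\ |\mathbf v-\mathbf u|<\varepsilon\Big\}.$$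
   Context: Empirical objects: write $\mathbf X_i=(X_{i1},\dots,X_{id})$, $U_{ij}=F_j(X_{ij})$, $\mathbf U_i=(U_{i1},\dots,U_{id})$ (so $\mathbf U_i$ has distribution function $C$), $F_n(\mathbf x)=\frac1n\sum_{i=1}^n\mathbf 1\{\mathbf X_i\le\mathbf x\}$ for $\mathbf x \in \mathbb R^d$, $G_n(\mathbf u)=\frac1n\sum_{i=1}^n\mathbf 1\{\mathbf U_i\le\mathbf u\}$ for $\mathbf u \in [0,1]^d$ (componentwise inequalities). For a distribution function $H$ on $\mathbb R$, $H^-(u)=\inf\{x:H(x)\ge u\}$ for $0<u\le1$ and $H^-(0)=\sup\{x:H(x)=0\}$. With $F_{nj}$ the $j$th marginal of $F_n$, the empirical copula is $C_n(\mathbf u)=F_n(F_{n1}^-(u_1),\dots,F_{nd}^-(u_d))$, $\mathbf u\in[0,1]^d$. For $j=1,\dots,d$, $\alpha_j(u_j)=\alpha(1,\dots,1,u_j,1,\dots,1)$ with $u_j$ at position $j$. $|\cdot|$ is the Euclidean norm, $\mathcal C([0,1])$ the set of continuous real functions on $[0,1]$. Hypi-semimetric: let $(\mathbb T,d)$ be a compact metric space (here $\mathbb T=[0,1]^d$) and $\ell^\infty(\mathbb T)$ the set of bounded functions $f:\mathbb T\to\mathbb R$. Put $f_\wedge(x)=\sup_{\varepsilon>0}\inf\{f(x'):d(x',x)<\varepsilon\}$, $f_\vee(x)=\inf_{\varepsilon>0}\sup\{f(x'):d(x',x)<\varepsilon\}$, $\operatorname{epi}f=\{(x,y)\in\mathbb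 T\times\mathbb R:f(x)\le y\}$, $\operatorname{hypo}f=\{(x,y)\in\mathbb T\times\mathbb R:y\le f(x)\}$, and $d_{\mathrm{hypi}}(f,g)=\max\{d_{\mathcal F}(\operatorname{epi}f_\wedge,\operatorname{epi}g_\wedge),d_{\mathcal F}(\operatorname{hypo}f_\vee,\operatorname{hypo}g_\vee)\}$, where $d_{\mathcal F}$ is a metric on the closed subsets of $\mathbb T\times\mathbb R$ inducing the Fell topology (equivalently Painlevé–Kuratowski convergence). $L^\infty(\mathbb T)$ is the metric space of equivalence classes $[f]=\{g\in\ell^\infty(\mathbb T):d_{\mathrm{hypi}}(f,g)=0\}$ with metric $d_{\mathrm{hypi}}([f],[g])=d_{\mathrm{hypi}}(f,g)$. Weak convergence is in the Hoffmann-Jørgensen sense: for arbitrary (possibly nonmeasurable) maps $X_n$ into a metric space and a Borel measurable $X$, $X_n\rightsquigarrow X$ means $E^*[h(X_n)]\to E[h(X)]$ for all bounded continuous real $h$ ($E^*$ outer expectation). ''$X_n\rightsquigarrow X$ in $(L^\infty(\mathbb T),d_{\mathrm{hypi}})$'' means $[X_n]\rightsquigarrow[X]$ in that metric space. *)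

(* Defs.v *)
From HB Require Import structures.
From mathcomp Require Import all_boot all_order all_algebra.
From mathcomp Require Import all_classical all_reals all_analysis.
From mathcomp Require Import measurable_realfun.

Set Implicit Arguments.
Unset Strict Implicit.
Unset Printing Implicit Defensive.

Import Order.TTheory GRing.Theory Num.Theory.
Import numFieldNormedType.Exports.

Local Open Scope classical_set_scope.
Local Open Scope ring_scope.

Section weak_convergence.
Context {R : realType}.

(* The infimum of E[Y] over measurable majorants Y for which E[Y] exists; the
   last clause is needed because the library integral is total. *)
Definition outer_expectation {dsp} {Om : measurableType dsp}
    (P : probability Om R) (Z : Om -> R) : \bar R :=
  ereal_inf [set (\int[P]_w Y w)%E | Y in [set Y : Om -> \bar R |
    [/\ measurable_fun setT Y,
        forall w, ((Z w)%:E <= Y w)%E &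
        (\int[P]_w (Y^\+ w) < +oo)%E \/ (\int[P]_w (Y^\- w) < +oo)%E]]].

(* The (pseudo)metric space under consideration is the subset [M] of [E] with
   the distance [dist]; values of [dist] outside [M] are irrelevant. *)
Context {E : Type} (M : set E) (dist : E -> E -> R).

Definition dist_open : set (set E) := [set O | O `<=` M /\
  forall x, O x -> exists2 e : R, 0 < e &
    forall y, M y -> dist x y < e -> O y].

Definition borel_measurable {dsp} {Om : measurableType dsp} (X : Om -> E) :=
  (forall w, M (X w)) /\
  forall B, <<s M, dist_open >> B -> measurable (X @^-1` B).

Definition bounded_continuous (h : E -> R) :=
  (exists K : R, forall x, M x -> `|h x| <= K) /\
  forall x, M x -> forall e : R, 0 < e -> exists2 r : R, 0 < r &
    forall y, M y -> dist x y < r -> `|h y - h x| < e.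

Definition weakly_converges
    {dsp} {Om : measurableType dsp} (P : probability Om R) (Xn : nat -> Om -> E)
    {dsp'} {Om' : measurableType dsp'} (P' : probability Om' R) (X : Om' -> E) :=
  [/\ forall n w, M (Xn n w),
      borel_measurable X &
      forall h, bounded_continuous h ->
        outer_expectation P (fun w => h (Xn n w)) @[n --> \oo] -->
        (\int[P']_w (h (X w))%:E)%E].

End weak_convergence.

Section fell.
Context {R : realType} {E : topologicalType}.

(* Basic open sets of the Fell (hit-and-miss) topology on closed subsets: the
   closed sets hitting each of the finitely many [G i] and missing [K]. *)
Definition fell_basic (k : nat) (G : 'I_k -> set E) (K : set E) :
    set (set E) :=
  [set A | [/\ closed A, forall i, A `&` G i !=set0 & A `&` K = set0]].

Definition fell_open (O : set (set E)) :=
  forall A, O A -> exists (k : nat) (G : 'I_k -> set E) (K : set E),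
    [/\ forall i, open (G i), compact K,
        fell_basic G K A & fell_basic G K `<=` O].

Definition fell_metric (dF : set E -> set E -> R) :=
  [/\ forall A B, closed A -> closed B -> 0 <= dF A B /\ dF A B = dF B A,
      forall A B, closed A -> closed B -> (dF A B = 0 <-> A = B),
      forall A B D, closed A -> closed B -> closed D ->
        dF A D <= dF A B + dF B D &
      forall O : set (set E), O `<=` [set A | closed A] ->
        (fell_open O <-> dist_open [set A | closed A] dF O)].

End fell.

Section hypi.
Context {R : realType} {T : pseudoMetricType R}.
Implicit Types f g : T -> R.

Definition linf : set (T -> R) :=
  [set f | exists K : R, forall x, `|f x| <= K].

Definition sup_dist f g : R := sup [set `|f x - g x| | x in [set: T]].

Definition lower_hull f (x : T) : R :=
  sup [set inf [set f y | y in ball x e] | e in [set e : R | 0 < e]].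

Definition upper_hull f (x : T) : R :=
  inf [set sup [set f y | y in ball x e] | e in [set e : R | 0 < e]].

Definition epi f : set (T * R) := [set p | f p.1 <= p.2].

Definition hypo f : set (T * R) := [set p | p.2 <= f p.1].

Variable dF : set (T * R) -> set (T * R) -> R.

Definition hypi_dist f g : R :=
  Num.max (dF (epi (lower_hull f)) (epi (lower_hull g)))
          (dF (hypo (upper_hull f)) (hypo (upper_hull g))).

Definition hypi_class f : set (T -> R) :=
  [set g | linf g /\ hypi_dist f g = 0].

Definition Linf : set (set (T -> R)) := [set hypi_class f | f in linf].

(* [get] picks a representative; the value does not depend on the choice when
   [dF] is a metric on closed sets. *)
Definition Linf_dist (A B : set (T -> R)) : R := hypi_dist (get A) (get B).

End hypi.

Section cube.
Context {R : realType} {d : nat}.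
Implicit Types u v x : 'rV[R]_d.

Definition in_cube : set 'rV[R]_d := [set u | forall j, 0 <= u ord0 j <= 1].

(* As a type, [cube] carries the library's subspace topology. *)
Definition cube : Type := set_type in_cube.

HB.instance Definition _ := PseudoMetric.copy cube (set_type in_cube).

Lemma in_cube1 : (const_mx 1 : 'rV[R]_d) \in in_cube.
Proof. by apply/mem_set => j; rewrite mxE ler01 lexx. Qed.

Definition cube1 : cube :=
  exist (fun u => u \in in_cube) (const_mx 1) in_cube1.

(* [subst_coord x j t] is x with its j-th coordinate replaced by t. *)
Definition subst_coord x (j : 'I_d) (t : R) : 'rV[R]_d :=
  \row_k (if k == j then t else x ord0 k).

(* alpha |-> alpha_j, meaningful for t in [0, 1]. *)
Definition margin (f : cube -> R) (j : 'I_d) (t : R) : R :=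
  f (insubd cube1 (subst_coord (const_mx 1) j t)).

Definition euclid x : R := Num.sqrt (\sum_j x ord0 j ^+ 2).

Definition leq_vec u v : bool := [forall j, u ord0 j <= v ord0 j].

Definition box u v : set 'rV[R]_d :=
  [set x | forall j, u ord0 j <= x ord0 j <= v ord0 j].

(* d-dimensional Lebesgue outer measure, by countable coverings with boxes. *)
Definition lebesgue_outer (A : set 'rV[R]_d) : \bar R :=
  ereal_inf
    [set (\sum_(0 <= k <oo) (\prod_j ((p k).2 ord0 j - (p k).1 ord0 j))%:E)%E
    | p in [set p : nat -> 'rV[R]_d * 'rV[R]_d |
        (forall k, leq_vec (p k).1 (p k).2) /\
        A `<=` \bigcup_k box (p k).1 (p k).2]].

End cube.
Arguments cube : clear implicits.

Section copula.
Context {R : realType} {d : nat}.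
Implicit Types (C : 'rV[R]_d -> R) (u v : 'rV[R]_d).

(* C restricted to the unit cube is the distribution function of a random
   vector with uniform margins; its values elsewhere are irrelevant. *)
Definition is_copula C :=
  exists Q : probability (d.-tuple R) R,
    (forall (j : 'I_d) (t : R), 0 <= t <= 1 ->
       Q [set v | tnth v j <= t] = t%:E) /\
    (forall u, in_cube u ->
       Q [set v | forall j, tnth v j <= u ord0 j] = (C u)%:E).

(* Difference quotient of C in its j-th argument, along the unit interval (so
   one-sided on the faces u_j = 0 and u_j = 1 of the cube). *)
Definition diff_quotient C (j : 'I_d) u (t : R) : R :=
  (C (subst_coord u j t) - C u) / (t - u ord0 j).

Definition quotient_filter (j : 'I_d) u : set_system R :=
  within `[0, 1] (u ord0 j)^'.

Definition has_partial C (j : 'I_d) : set 'rV[R]_d :=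
  [set u | in_cube u /\ cvg (diff_quotient C j u @ quotient_filter j u)].

Definition partial C (j : 'I_d) u : R :=
  lim (diff_quotient C j u @ quotient_filter j u).

(* The set of points where every partial derivative exists and is continuous,
   the j-th one as a function on the set where it exists. *)
Definition smooth_set C : set 'rV[R]_d :=
  [set u | in_cube u /\ forall j, has_partial C j u /\
     partial C j v @[v --> within (has_partial C j) (nbhs u)] -->
     partial C j u].

Definition dC C (a : 'I_d -> R -> R) u : R :=
  sup [set inf [set \sum_j partial C j v * a j (v ord0 j) | v in
                 [set v | smooth_set C v /\ euclid (v - u) < e]]
      | e in [set e : R | 0 < e]].

End copula.

Section empirical.
Context {R : realType} {d : nat} {dsp : measure_display}
  {Om : measurableType dsp} (P : probability Om R)
  (X : nat -> {RV P >-> d.-tuple R}).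
Implicit Types (u x : 'rV[R]_d) (w : Om).

Definition strictly_stationary :=
  forall (k m : nat) (B : set (k.-tuple (d.-tuple R))), measurable B ->
    P [set w | B [tuple X (m + i)%N w | i < k]] =
    P [set w | B [tuple X i w | i < k]].

Definition joint_df x : R :=
  fine (P [set w | forall j, tnth (X 0 w) j <= x ord0 j]).

Definition marginal_df (j : 'I_d) (t : R) : R :=
  fine (P [set w | tnth (X 0 w) j <= t]).

(* Sample sizes: the n observations are X_0, ..., X_(n-1); for n = 0 all
   averages are 0. *)
Definition emp_df (n : nat) w x : R :=
  n%:R^-1 * \sum_(i < n) [forall j, (tnth (X i w) j <= x ord0 j)%R]%:R.

Definition emp_marginal_df (n : nat) w (j : 'I_d) (t : R) : R :=
  n%:R^-1 * \sum_(i < n) ((tnth (X i w) j <= t)%R : bool)%:R.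

Definition emp_uniform_df (n : nat) w u : R :=
  n%:R^-1 *
  \sum_(i < n) [forall j, (marginal_df j (tnth (X i w) j) <= u ord0 j)%R]%:R.

Definition gen_inverse (H : R -> R) (u : R) : R :=
  if u == 0 then sup [set t | H t = 0] else inf [set t | u <= H t].

Definition emp_copula (n : nat) w u : R :=
  emp_df n w (\row_j gen_inverse (emp_marginal_df n w j) (u ord0 j)).

Variable C : 'rV[R]_d -> R.

Definition empirical_process (n : nat) w : cube R d -> R :=
  fun u : cube R d => Num.sqrt n%:R * (emp_uniform_df n w (val u) - C (val u)).

Definition empirical_copula_process (n : nat) w : cube R d -> R :=
  fun u : cube R d => Num.sqrt n%:R * (emp_copula n w (val u) - C (val u)).

End empirical.

Definition limit_path {R : realType} {d : nat} (C : 'rV[R]_d -> R)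
    (alpha : cube R d -> R) : cube R d -> R :=
  fun u => alpha u + dC C (fun j t => - margin alpha j t) (val u).

(* Main.v *)
(* The j-th coordinates y_j of the images under F_j of the empirical quantiles
   are quantiles of the transformed sample, so sqrt n (y_j - u_j) is uniformly
   close to - alpha_j(u_j) when alpha_n is uniformly close to a continuous path
   alpha vanishing on the null faces, and the empirical copula process is then
   alpha(u) + sqrt n (C(y) - C(u)) up to a small error. By Tonelli, almost every
   small translate of a segment meets the full set S in almost all of its
   points, so an increment of the Lipschitz function C along a segment lies
   between the extreme values at nearby points of S of any derivative that C has
   there. For segments parallel to the axes this shows that C is strictly
   differentiable at the points of S; for arbitrary segments it then shows that
   the process lies locally between the infimum and the supremum over nearby v
   in S of L(v) = alpha(v) - sum_j C'_j(v) alpha_j(v_j). The limit path is the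
   lower semicontinuous function generated by L, and Painleve-Kuratowski
   convergence of epigraphs and hypographs follows. All this is deterministic;
   an extended continuous mapping argument transfers it to weak convergence. *)

Require Import Defs.
From HB Require Import structures.
From mathcomp Require Import all_boot all_order all_algebra.
From mathcomp Require Import all_classical all_reals all_analysis.
From mathcomp Require Import measurable_realfun.
From mathcomp Require Import ring lra.

Set Implicit Arguments.
Unset Strict Implicit.
Unset Printing Implicit Defensive.

Import Order.TTheory GRing.Theory Num.Theory.
Import numFieldNormedType.Exports.

Local Open Scope classical_set_scope.
Local Open Scope ring_scope.

(** * Null sets and increments along segments *)

(** Off [smooth_set C] only the Lipschitz bound is known, and the segment from [u] to the
    transformed empirical quantile may lie wholly in that null set, so no mean value theorem applies
    on the segment itself. What survives the passage to a parallel segment is a one-sided inequality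
    with arbitrarily small slack. Increment estimates are therefore proved as lower bounds and
    applied to both [C] and [- C] through a sign [sg] of modulus 1; the two signs later serve
    epigraphs and hypographs. Only partial derivatives are given, so directional derivatives in
    oblique directions become available only after the axis-parallel case. Since the processes need
    not be measurable, outer expectations are handled by monotonicity alone, and the almost sure
    properties of the limit enter as properties of single paths. One of them, the vanishing on the
    null faces, is not assumed: the limit inherits it from the empirical processes. *)

Section uniform_measure.
Context {R : realType}.

Lemma uniform01E (A : set R) : measurable A ->
  uniform_prob (@ltr01 R) A = lebesgue_measure (A `&` `[0, 1]).
Proof.
move=> mA; rewrite /uniform_prob integral_uniform_pdf.
rewrite (eq_integral (cst 1%E)); last first.
  move=> x; rewrite inE /= => -[_]; rewrite in_itv /= /uniform_pdf => ->.
  by rewrite subr0 invr1.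
rewrite integral_cst ?mul1e//; exact: measurableI.
Qed.

Lemma uniform01_le (a b : R) (A : set R) : a <= b -> measurable A ->
  A `&` `[0, 1] `<=` `[a, b] -> (uniform_prob (@ltr01 R) A <= (b - a)%:E)%E.
Proof.
move=> ab mA Aab; rewrite uniform01E//.
apply: (@le_trans _ _ (lebesgue_measure `[a, b]%classic)).
  apply: le_measure => //; rewrite inE//; exact: measurableI.
rewrite lebesgue_measure_itv /= lte_fin; case: ifPn => //.
by rewrite lee_fin subr_ge0.
Qed.

Lemma uniform01_itvoc (a b : R) : 0 <= a -> a <= b -> b <= 1 ->
  uniform_prob (@ltr01 R) `]a, b]%classic = (b - a)%:E.
Proof.
move=> a0 ab b1; rewrite uniform01E// setIidl; last first.
  move=> x /=; rewrite !in_itv /= => /andP[ax xb].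
  by rewrite (le_trans a0 (ltW ax)) (le_trans xb b1).
rewrite lebesgue_measure_itv /= lte_fin.
case: ltP => // ba; have -> : b = a by apply/eqP; rewrite eq_le ab ba.
by rewrite subrr.
Qed.

Lemma measurable_forall_ord dsp (T : measurableType dsp) n
    (P : 'I_n -> T -> bool) :
  (forall j, measurable_fun setT (P j)) ->
  measurable [set w | forall j, P j w].
Proof.
move=> mP.
have -> : [set w | forall j, P j w] = \bigcap_(j in [set: 'I_n]) [set w | P j w].
  by apply/seteqP; split => [w Pw j _|w Pw j]; apply: Pw.
apply: fin_bigcap_measurable => // j _.
rewrite -[X in measurable X]setTI; have := mP j measurableT [set true].
by apply.
Qed.

Lemma measurable_between dsp (T : measurableType dsp) n
    (Z : 'I_n -> T -> R) (a b : 'I_n -> R) :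
  (forall j, measurable_fun setT (Z j)) ->
  measurable [set w | forall j, a j <= Z j w <= b j].
Proof.
move=> mZ; apply: (measurable_forall_ord (P := fun j w => a j <= Z j w <= b j)).
by move=> j; apply: measurable_and; apply: measurable_fun_ler.
Qed.

(** Induction on the dimension, one uniform factor at a time. Leaving the sample space abstract
    avoids a product measure on row vectors, and an upper bound for the probability of boxes is all
    that coverings by boxes require. *)
Lemma uniform_cube n : exists dsp (T : measurableType dsp)
    (mu : probability T R) (Z : 'I_n -> T -> R),
  [/\ forall j, measurable_fun setT (Z j), forall j w, 0 <= Z j w <= 1 &
    forall a b : 'I_n -> R, (forall j, a j <= b j) ->
      (mu [set w | forall j, (a j <= Z j w <= b j)%R] <=
       (\prod_j (b j - a j))%:E)%E].
Proof.
elim: n => [|n [dsp [T [mu [Z [mZ Z01 muZ]]]]]].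
  exists _, _, (uniform_prob (@ltr01 R)), (fun _ _ => 0); split => //.
  - by move=> j w; rewrite lexx ler01.
  - move=> a b _; rewrite big_ord0 -(probability_setT (uniform_prob (@ltr01 R))).
    by rewrite (_ : [set w | _] = setT)//; apply/seteqP; split => // w _ [].
(* The new factor is the whole line; clamping puts its coordinate in [0, 1] at every point and
   changes nothing on the support of the uniform law. *)
pose cl (t : R) := Num.min 1 (Num.max 0 t).
pose Z' (j : 'I_n.+1) (w : R * T) : R :=
  if unlift ord0 j is Some k then Z k w.2 else cl w.1.
have cl01 t : 0 <= cl t <= 1.
  by rewrite /cl ge_min lexx /= le_min ler01 /= le_max lexx.
have mcl : measurable_fun setT cl.
  by apply: measurable_minr => //; apply: measurable_maxr.
have mZ' j : measurable_fun setT (Z' j).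
  rewrite /Z'; case: (unlift ord0 j) => [k|].
    by apply: measurableT_comp => //; exact: measurable_snd.
  by apply: measurableT_comp => //; exact: measurable_fst.
exists _, _, ((uniform_prob (@ltr01 R) \x mu)%E : probability _ _), Z'.
split => //.
  by move=> j w; rewrite /Z'; case: (unlift ord0 j) => [k|].
move=> a b ab.
pose A := cl @^-1` `[a ord0, b ord0]%classic.
pose B := [set w | forall j, a (lift ord0 j) <= Z j w <= b (lift ord0 j)].
have mA : measurable A by rewrite -[A]setTI; apply: mcl.
have mB : measurable B by apply: measurable_between.
have -> : [set w : R * T | forall j, (a j <= Z' j w <= b j)%R] = A `*` B.
  apply/seteqP; split => -[r w] /=.
    move=> H; split; first by have := H ord0; rewrite /Z' unlift_none /A /= in_itv.
    by move=> j; have := H (lift ord0 j); rewrite /Z' liftK.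
  move=> [+ HB] j; rewrite /A /= in_itv /= /Z' => HA.
  by case: unliftP => [k ->|->].
rewrite [leLHS](product_measure1E (uniform_prob (@ltr01 R)) mu mA mB).
rewrite big_ord_recl EFinM.
apply: lee_pmul => //; last by apply: muZ.
apply: uniform01_le => // t [] /=; rewrite /A /= !in_itv /= => + /andP[t0 t1].
by rewrite /cl (max_idPr t0) (min_idPr t1).
Qed.

End uniform_measure.

Section line_avoid.
Context {R : realType}.

(** The preimage of a box under [z |-> q + D z] is again a box, with sides divided by [|D j|] and
    endpoints exchanged where [D j < 0]. *)
Lemma uniform_cube_box n dsp (T : measurableType dsp)
    (mu : probability T R) (Z : 'I_n -> T -> R) :
  (forall a b : 'I_n -> R, (forall j, a j <= b j) ->
      (mu [set w | forall j, (a j <= Z j w <= b j)%R] <=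
       (\prod_j (b j - a j))%:E)%E) ->
  forall (D q a b : 'I_n -> R), (forall j, D j != 0) -> (forall j, a j <= b j) ->
  (mu [set w | forall j, (a j <= q j + D j * Z j w <= b j)%R] <=
       ((\prod_j `|D j|)^-1 * \prod_j (b j - a j))%:E)%E.
Proof.
move=> muZ D q a b D0 ab.
pose a' j := if 0 < D j then (a j - q j) / D j else (b j - q j) / D j.
pose b' j := if 0 < D j then (b j - q j) / D j else (a j - q j) / D j.
have E j x : (a j <= q j + D j * x <= b j) = (a' j <= x <= b' j).
  have -> : (a j <= q j + D j * x) = (a j - q j <= x * D j).
    by rewrite lerBlDl mulrC.
  have -> : (q j + D j * x <= b j) = (x * D j <= b j - q j).
    by rewrite lerBrDl mulrC.
  rewrite /a' /b'; case: ltP => Dj.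
    by rewrite -(ler_pdivrMr _ _ Dj) -(ler_pdivlMr _ _ Dj).
  have {}Dj : D j < 0 by rewrite lt_neqAle D0.
  by rewrite -(ler_ndivlMr _ _ Dj) -(ler_ndivrMr _ _ Dj) andbC.
have -> : [set w | forall j, (a j <= q j + D j * Z j w <= b j)%R] =
    [set w | forall j, (a' j <= Z j w <= b' j)%R].
  by apply/seteqP; split => w /= H j; [rewrite -E|rewrite E].
have -> : (\prod_j `|D j|)^-1 * \prod_j (b j - a j) = \prod_j (b' j - a' j).
  rewrite -prodfV -big_split /=; apply: eq_bigr => j _.
  rewrite /a' /b'; have := D0 j; case: ltP => Dj D0j.
    by rewrite gtr0_norm//; field.
  by rewrite ler0_norm//; field.
apply: muZ => j; rewrite /a' /b'; case: ltP => Dj.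
  by rewrite ler_pM2r ?invr_gt0// lerD2r.
have {}Dj : D j < 0 by rewrite lt_neqAle D0.
by rewrite ler_nM2r ?invr_lt0// lerD2r.
Qed.

(* A null set is avoided, up to a small set of times, by some line parallel to
   any given one: by Tonelli this holds for a random translate. *)
Lemma line_avoid d (N : set 'rV[R]_d) (D p h : 'I_d -> R) (eps : R) :
  lebesgue_outer N = 0%E -> (forall j, D j != 0) -> 0 < eps ->
  exists2 z : 'I_d -> R, (forall j, 0 <= z j <= 1) &
  exists A : set R, [/\ open A, (uniform_prob (@ltr01 R) A < eps%:E)%E &
    forall t, 0 <= t <= 1 -> N (\row_j (p j + D j * z j + t * h j)) -> A t].
Proof.
move=> N0 D0 eps0.
have [dsp [T [mu [Z [mZ Z01 muZ]]]]] := @uniform_cube R d.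
pose U := uniform_prob (@ltr01 R).
pose c := \prod_j `|D j|.
have c0 : 0 < c by apply: prodr_gt0 => j _; rewrite normr_gt0.
(* The factor [c] cancels the Jacobian from [uniform_cube_box]; the other half of [eps] is kept for
   the passage to an open set. *)
have : (lebesgue_outer N < (eps / 2 * c)%:E)%E.
  by rewrite N0 lte_fin !mulr_gt0.
rewrite /lebesgue_outer => /ereal_inf_lt [_ [B [lB NB] <-] sB].
pose K k := [set x : T * measurableTypeR R | forall j,
  (B k).1 ord0 j <= p j + x.2 * h j + D j * Z j x.1 <= (B k).2 ord0 j].
have mK k : measurable (K k).
  apply: (measurable_between (Z := fun j (x : T * measurableTypeR R) =>
    p j + x.2 * h j + D j * Z j x.1)) => j /=.
  apply: (@measurable_funD _ _ R).
    apply: (@measurable_funD _ _ R) => //.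
    by apply: (@measurable_funM _ _ R) => //; exact: measurable_snd.
  apply: (@measurable_funM _ _ R) => //.
  exact: (measurableT_comp (mZ j) measurable_fst).
have mUK : measurable (\bigcup_k K k) by exact: bigcupT_measurable.
have KB k : ((mu \x U) (K k) <=
    (c^-1 * \prod_j ((B k).2 ord0 j - (B k).1 ord0 j))%:E)%E.
  (* The product taken in the other order integrates sections at a fixed time [t], to which
     [uniform_cube_box] applies. *)
  have -> : ((mu \x U) (K k) = (mu \x^ U) (K k))%E.
    apply: (product_measure_unique (m' := (mu \x^ U)%E)) => // X Y mX mY.
    exact: product_measure2E.
  rewrite [leLHS](_ : _ = \int[U]_t mu (ysection (K k) t))%E//.
  rewrite -[leRHS]mule1 -(probability_setT U) -integral_cst//.
  apply: ge0_le_integral => //.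
  - exact: measurable_fun_ysection.
  - move=> t _; rewrite (_ : ysection _ _ = [set w | forall j,
      (B k).1 ord0 j <= (p j + t * h j) + D j * Z j w <= (B k).2 ord0 j]).
      apply: uniform_cube_box => // j.
      by have /forallP := lB k; apply.
    by apply/seteqP; split => w; rewrite /ysection /= inE.
have UKlt : ((mu \x U) (\bigcup_k K k) < (eps / 2)%:E)%E.
  apply: (@le_lt_trans _ _ (\sum_(0 <= k <oo) (mu \x U) (K k))%E).
    exact: (measure_sigma_subadditive (mu \x U)%E).
  apply: (@le_lt_trans _ _ (c^-1%:E *
     \sum_(0 <= k <oo) (\prod_j ((B k).2 ord0 j - (B k).1 ord0 j))%:E)%E).
    rewrite -nneseriesZl//; last first.
      move=> k _; rewrite lee_fin; apply: prodr_ge0 => j _; rewrite subr_ge0.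
      by have /forallP := lB k; apply.
    by apply: lee_nneseries => // k _; rewrite -EFinM.
  rewrite muleC -lte_pdivlMr// ?invr_gt0// invrK.
  by rewrite -EFinM.
(* If every translate had a section of measure at least [eps / 2], so would the integral over all
   translates. *)
have [w wK] : exists w, (U (xsection (\bigcup_k K k) w) < (eps / 2)%:E)%E.
  apply/not_existsP => H; move: UKlt; apply/negP; rewrite -leNgt.
  rewrite -[leLHS]mule1 -(probability_setT mu) -integral_cst//.
  rewrite [leRHS](_ : _ = \int[mu]_w U (xsection (\bigcup_k K k) w))%E//.
  apply: ge0_le_integral => //.
  - by move=> w _; rewrite /= lee_fin divr_ge0// ltW.
  - exact: measurable_fun_xsection.
  - by move=> w _; have /negP := H w; rewrite -leNgt.
exists (Z^~ w) => //.
pose A0 := xsection (\bigcup_k K k) w `&` `[0, 1].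
have mA0 : measurable A0.
  by apply: measurableI => //; exact: measurable_xsection.
have A0lt : (lebesgue_measure A0 < (eps / 2)%:E)%E.
  by rewrite -uniform01E//; exact: measurable_xsection.
(* Openness lets [increment_off_open] move to the right from a bad time without leaving the bad
   set. *)
have [A [oA A0A AA0]] : exists A : set R, [/\ open A, A0 `<=` A &
    (lebesgue_measure (A `\` A0) < (eps / 2)%:E)%E].
  apply: lebesgue_regularity_outer => //; last by rewrite divr_gt0.
  by apply: lt_trans A0lt _; rewrite ltry.
have mA : measurable A by exact: open_measurable.
exists A; split => //.
  rewrite uniform01E//.
  apply: (@le_lt_trans _ _ (lebesgue_measure A)).
    by apply: le_measure; rewrite ?inE//; exact: measurableI.
  have -> : lebesgue_measure A =
      (lebesgue_measure A0 + lebesgue_measure (A `\` A0))%E.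
    by rewrite [LHS](measureDI lebesgue_measure mA mA0) addeC setIidr.
  by rewrite (splitr eps) EFinD lteD.
move=> t t01 Nt; apply: A0A; split; last by rewrite /= in_itv.
have [k _ Bk] := NB _ Nt.
rewrite /xsection /= inE; exists k => // j /=.
by have := Bk j; rewrite mxE addrAC.
Qed.

End line_avoid.

Section line_increment.
Context {R : realType}.

(** Continuous induction: the set [E] of times up to which [psi] stays above [psi 0] contains its
    supremum because [psi] is Lipschitz, and the increase to the right of a supremum below 1 would
    push it further. *)
Lemma right_increasing (psi : R -> R) (K : R) :
  (forall s t : R, 0 <= s -> s <= t -> t <= 1 -> `|psi t - psi s| <= K * (t - s)) ->
  (forall t : R, 0 <= t < 1 -> exists2 s0, 0 < s0 &
     forall s, 0 < s < s0 -> t + s <= 1 -> psi t <= psi (t + s)) ->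
  psi 0 <= psi 1.
Proof.
move=> lip inc.
pose E := [set t | 0 <= t <= 1 /\ forall s, 0 <= s <= t -> psi 0 <= psi s].
have E0 : E 0.
  split; first by rewrite lexx ler01.
  by move=> s; rewrite -eq_le => /eqP <-.
have hE : has_sup E.
  by split; [exists 0|exists 1 => t [/andP[]]].
pose c := sup E.
have c0 : 0 <= c by apply: (ub_le_sup hE.2).

have c1 : c <= 1 by apply: ge_sup; [exists 0|move=> t [/andP[]]].
have K0 : 0 <= K.
  have := lip 0 1 (lexx 0) ler01 (lexx 1); rewrite subr0 mulr1.
  exact: le_trans.
have below s : 0 <= s -> s < c -> psi 0 <= psi s.
  move=> s0 sc.
  have [t [/andP[t0 t1] Et] st] := sup_adherent (ltac:(by rewrite subr_gt0) : 0 < c - s) hE.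
  apply: Et; rewrite s0 /= ltW//; apply: le_lt_trans st.
  by rewrite /c opprB addrC subrK.
have psic : psi 0 <= psi c.
  move: c0; rewrite le_eqVlt => /predU1P[<-//|cgt0].
  apply/ler_addgt0Pr => e e0.
  pose r := Num.min (c / 2) (e / (K + 1)).
  have K1 : 0 < K + 1 by rewrite ltr_wpDl.
  have r0 : 0 < r by rewrite lt_min !divr_gt0.
  have rc : r <= c / 2 by rewrite ge_min lexx.
  have re : K * r <= e.
    apply: (@le_trans _ _ (K * (e / (K + 1)))).
      by rewrite ler_wpM2l// ge_min lexx orbT.
    by rewrite mulrCA ler_piMr ?(ltW e0)// ler_pdivrMr// mul1r lerDl.
  have := below (c - r) (ltac:(lra)) (ltac:(lra)).
  have := lip (c - r) c (ltac:(lra)) (ltac:(lra)) c1.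
  rewrite opprB addrCA subrr addr0 ler_norml => /andP[+ _].
  lra.
have Ec : E c.
  split; first by rewrite c0 c1.
  move=> s /andP[s0]; rewrite le_eqVlt => /predU1P[->//|sc]; exact: below.
move: c1; rewrite le_eqVlt => /predU1P[c1|c1]; first by move: psic; rewrite c1.
have [s0 s00 Hs] := inc c (ltac:(by rewrite c0)).
pose r := Num.min (s0 / 2) (1 - c).
have r0 : 0 < r by rewrite lt_min divr_gt0//= subr_gt0.
have rs : r <= s0 / 2 by rewrite ge_min lexx.
have rc : r <= 1 - c by rewrite ge_min lexx orbT.
suff /(ub_le_sup hE.2) : E (c + r) by rewrite -/c => ?; lra.
split; first by apply/andP; split; lra.
move=> s /andP[s0' sr].
have [sc|cs] := leP s c; first by apply: Ec.2; rewrite s0'.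
apply: le_trans psic _.
rewrite -[s](subrK c) addrC; apply: Hs; last lra.
by apply/andP; split; lra.
Qed.

(* Adding [K] times the measure of the part of [A] swept so far compensates for
   the lack of control on [A], so that the corrected function is locally
   increasing to the right everywhere. *)
Lemma increment_off_open (phi : R -> R) (L m eps : R) (A : set R) :
  0 <= L ->
  (forall s t : R, 0 <= s -> s <= t -> t <= 1 -> `|phi t - phi s| <= L * (t - s)) ->
  open A -> (uniform_prob (@ltr01 R) A < eps%:E)%E ->
  (forall t : R, 0 <= t < 1 -> ~ A t -> exists2 s0, 0 < s0 &
     forall s, 0 < s < s0 -> t + s <= 1 -> m * s <= phi (t + s) - phi t) ->
  m - (L + `|m|) * eps <= phi 1 - phi 0.
Proof.
move=> L0 lip oA Aeps der.
pose U : probability (measurableTypeR R) R := uniform_prob (@ltr01 R).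
have mA : measurable A by exact: open_measurable.
have mI (a b : R) :
    measurable (A `&` `]a, b]%classic : set (measurableTypeR R)).
  exact: measurableI.
pose rho t := fine (U (A `&` `]0, t]%classic)).
have fU (B : set (measurableTypeR R)) : measurable B -> U B \is a fin_num.
  by move=> mB; exact: fin_num_measure.
have rhoB s t : 0 <= s -> s <= t ->
    rho t - rho s = fine (U (A `&` `]s, t]%classic)).
  move=> s0 st; rewrite /rho.
  have -> : A `&` `]0, t]%classic =
      (A `&` `]0, s]%classic) `|` (A `&` `]s, t]%classic).
    by rewrite -setIUr -itv_bndbnd_setU// bnd_simp.
  rewrite [X in fine X - _](measureU U)//.
  - rewrite fineD; [by rewrite addrC addKr| |]; apply: fU; exact: mI.
  - rewrite setIACA setIid; apply/seteqP; split => // x [_ []] /=.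
    by rewrite !in_itv /= => /andP[_ xs] /andP[]; rewrite ltNge xs.
have rho_ge s t : 0 <= s -> s <= t -> 0 <= rho t - rho s.
  by move=> s0 st; rewrite rhoB// fine_ge0.
have rho_le s t : 0 <= s -> s <= t -> t <= 1 -> rho t - rho s <= t - s.
  move=> s0 st t1; rewrite rhoB// -lee_fin fineK; last by apply: fU; exact: mI.
  rewrite -uniform01_itvoc//; apply: (le_measure U); rewrite ?inE//; exact: mI.
have rho_eq s t : 0 <= s -> s <= t -> t <= 1 -> `]s, t]%classic `<=` A ->
    rho t - rho s = t - s.
  move=> s0 st t1 stA; rewrite rhoB// setIidr//.
  by rewrite [X in fine X](uniform01_itvoc s0 st t1).
have rho0 : rho 0 = 0.
  rewrite /rho [X in U X](_ : _ = set0) ?measure0//.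
  apply/seteqP; split => // x [_ /=]; rewrite in_itv /= => /andP[x0].
  by rewrite leNgt x0.
have rho1 : rho 1 <= eps.
  rewrite -lee_fin fineK; last by apply: fU; exact: mI.
  apply: le_trans (ltW Aeps).
  apply: (le_measure U); rewrite ?inE//; exact: mI.
pose K := L + `|m|.
have K0 : 0 <= K by rewrite addr_ge0.
pose psi t := phi t - m * t + K * rho t.
suff : psi 0 <= psi 1.
  rewrite /psi rho0 !mulr0 subr0 addr0 mulr1 => H.
  have : K * rho 1 <= K * eps by rewrite ler_wpM2l.
  by rewrite /K in H * => ?; lra.
apply: (@right_increasing psi (L + `|m| + K)).
  move=> s t s0 st t1.
  have -> : psi t - psi s = (phi t - phi s) + (- (m * (t - s))) + K * (rho t - rho s).
    by rewrite /psi; ring.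
  rewrite [leRHS]mulrDl [X in _ <= X + _]mulrDl.
  apply: le_trans (ler_normD _ _) _; apply: lerD.
    apply: le_trans (ler_normD _ _) _; apply: lerD; first exact: lip.
    by rewrite normrN normrM (@ger0_norm _ (t - s))// subr_ge0.
  have r0 := rho_ge _ _ s0 st.
  by rewrite (ger0_norm (mulr_ge0 K0 r0)) ler_wpM2l// rho_le.
move=> t /andP[t0 t1].
have [At|nAt] := pselect (A t); last first.
  have [s0 s00 H] := der t (ltac:(by rewrite t0)) nAt.
  exists s0 => // s ss ts1; have := H s ss ts1.
  have : 0 <= K * (rho (t + s) - rho t).
    by rewrite mulr_ge0// rho_ge//; lra.
  rewrite /psi; lra.
(* Just after a point of [A] the function [rho] grows at unit rate, and [K = L + |m|] outweighs the
   steepest possible descent of [phi t - m * t]. *)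
have [e /= e0 He] := (@nbhs_ballP R R t A).1 (open_nbhs_nbhs (conj oA At)).
exists e => // s /andP[s0 se] ts1.
have rE : rho (t + s) - rho t = s.
  rewrite rho_eq//; [by ring|lra|].
  move=> x /=; rewrite in_itv /= => /andP[tx xts]; apply: He.
  by rewrite /ball /= ltr_norml; apply/andP; split; lra.
have := lip t (t + s) t0 (ltac:(lra)) ts1.
rewrite ler_norml => /andP[+ _].
have -> : t + s - t = s by ring.
have : m * s <= `|m| * s by rewrite ler_wpM2r ?ler_norm// ltW.
have : K * (rho (t + s) - rho t) = L * s + `|m| * s by rewrite rE /K; ring.
rewrite /psi; lra.
Qed.

(** [line_avoid] provides a parallel segment that meets [S] outside a small open set of times,
    [increment_off_open] bounds the increment along it, and the Lipschitz property carries the bound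
    back to [p] and [q]. The derivative is tested only at points of [S] near the box spanned by the
    segment. *)
Lemma line_increment d (f : 'rV[R]_d -> R) (L : R) (S : set 'rV[R]_d)
    (p q : 'rV[R]_d) (m delta : R) :
  0 <= L ->
  (forall u v, in_cube u -> in_cube v ->
     `|f u - f v| <= L * \sum_j `|u ord0 j - v ord0 j|) ->
  lebesgue_outer (in_cube `\` S) = 0%E ->
  in_cube p -> in_cube q -> (forall j, `|q ord0 j - p ord0 j| <= 2^-1) ->
  0 < delta ->
  (forall x, S x ->
     (forall j, exists2 t, 0 <= t <= 1 &
        `|x ord0 j - (p ord0 j + t * (q ord0 j - p ord0 j))| <= delta) ->
     forall eta, 0 < eta -> exists2 s0, 0 < s0 & forall s, 0 < s < s0 ->
       in_cube (x + s *: (q - p)) ->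
       (m - eta) * s <= f (x + s *: (q - p)) - f x) ->
  m <= f q - f p.
Proof.
move=> L0 lip S0 cp cq pq d0 der.
pose h j := q ord0 j - p ord0 j.
pose L' := L * \sum_j `|h j|.
have L'0 : 0 <= L' by rewrite mulr_ge0// sumr_ge0.
(* The three terms pay for the slack [eta] in the derivative, for the bad times of measure below
   [eta] (with [|m - eta| <= |m| + 1]), and for moving both endpoints by at most [eta] in each
   coordinate. *)
pose M := 1 + (L' + `|m| + 1) + 2 * (L * d%:R).
have M0 : 0 < M.
  rewrite /M; have := mulr_ge0 L0 (ler0n R d); have := normr_ge0 m; lra.
suff H eta : 0 < eta -> eta <= 1 -> m <= f q - f p + M * eta.
  apply/ler_addgt0Pr => e e0.
  pose r := Num.min 1 (e / M).
  have r0 : 0 < r by rewrite lt_min ltr01 divr_gt0.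
  apply: le_trans (H r r0 _) _; first by rewrite ge_min lexx.
  by rewrite lerD2l mulrC -ler_pdivlMr// ge_min lexx orbT.
move=> eta0 eta1.
pose dl := Num.min (Num.min delta 4^-1) eta.
have dl0 : 0 < dl by rewrite !lt_min d0 eta0 invr_gt0 ltr0n.
have dld : dl <= delta by rewrite !ge_min lexx.
have dl4 : dl <= 4^-1 by rewrite !ge_min lexx orbT.
have dle : dl <= eta by rewrite !ge_min lexx orbT.
(* The sign of each shift is chosen so that the translated segment stays in the
   cube; this is where the segment must be short. *)
pose D j := if (p ord0 j <= 1 - dl) && (q ord0 j <= 1 - dl) then dl else - dl.
have D0 j : D j != 0 by rewrite /D; case: ifP => _; rewrite ?oppr_eq0 gt_eqF.
have [z z01 [A [oA Aeta HA]]] :=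
  line_avoid (fun j => p ord0 j) h S0 D0 eta0.
have Dz j : `|D j * z j| <= dl.
  have /andP[z0 z1] := z01 j.
  have -> : dl = `|D j| by rewrite /D; case: ifP => _; rewrite ?normrN gtr0_norm.
  by rewrite normrM ler_piMr// ger0_norm.
pose pt (t : R) : 'rV[R]_d := \row_j (p ord0 j + D j * z j + t * h j).
have cpt t : 0 <= t <= 1 -> in_cube (pt t).
  move=> /andP[t0 t1] j; rewrite mxE.
  have /andP[p0 p1] := cp j; have /andP[q0 q1] := cq j.
  have /andP[z0 z1] := z01 j.
  have := pq j; rewrite ler_norml => /andP[pq1 pq2].
  have zz : 0 <= dl * z j <= dl by rewrite mulr_ge0 ?(ltW dl0)//= ler_piMr// ltW.
  have tp1 : 0 <= t * q ord0 j by rewrite mulr_ge0.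
  have tp2 : 0 <= (1 - t) * p ord0 j by rewrite mulr_ge0// subr_ge0.
  have tp3 : t * q ord0 j <= t * 1 by rewrite ler_wpM2l.
  have tp4 : (1 - t) * p ord0 j <= (1 - t) * 1 by rewrite ler_wpM2l// subr_ge0.
  move: zz => /andP[zz1 zz2].
  have -> : p ord0 j + D j * z j + t * h j =
     t * q ord0 j + (1 - t) * p ord0 j + D j * z j by rewrite /h; ring.
  rewrite /D; case: ifPn => [/andP[pd qd]|].
    have t5 : t * q ord0 j <= t * (1 - dl) by rewrite ler_wpM2l.
    have t6 : (1 - t) * p ord0 j <= (1 - t) * (1 - dl).
      by rewrite ler_wpM2l// subr_ge0.
    by apply/andP; split; lra.
  (* One endpoint exceeds [1 - dl >= 3/4] and the other is within 1/2 of it, so both are at least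
     [1/4 >= dl] and can be lowered. *)
  rewrite negb_and -!ltNge => pqd.
  have [pd qd] : dl <= p ord0 j /\ dl <= q ord0 j.
    by move: pqd => /orP[] ?; split; lra.
  have t5 : t * dl <= t * q ord0 j by rewrite ler_wpM2l.
  have t6 : (1 - t) * dl <= (1 - t) * p ord0 j.
    by rewrite ler_wpM2l// subr_ge0.
  by apply/andP; split; lra.
have ptD t s : pt (t + s) = pt t + s *: (q - p).
  by apply/rowP => j; rewrite !mxE /h; ring.
pose phi t := f (pt t).
have H1 : (m - eta) - (L' + `|m - eta|) * eta <= phi 1 - phi 0.
  apply: (increment_off_open (A := A)) => //.
    move=> s t s0 st t1; rewrite /phi.
    apply: le_trans (lip _ _ _ _) _.
    - by apply: cpt; apply/andP; split; lra.
    - by apply: cpt; apply/andP; split; lra.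
    rewrite /L' -mulrA ler_wpM2l// mulr_suml ler_sum// => j _.
    rewrite !mxE opprD addrACA subrr add0r -mulrBl normrM mulrC.
    by rewrite (@ger0_norm _ (t - s))// subr_ge0.
  move=> t /andP[t0 t1] nAt.
  have t01 : 0 <= t <= 1 by rewrite t0 ltW.
  have St : S (pt t).
    by apply: contrapT => nS; apply: nAt; apply: HA => //; split => //; apply: cpt.
  have [|s0 s00 Hs] := der _ St _ eta eta0.
    move=> j; exists t => //.
    rewrite !mxE -/(h j) (_ : _ - _ = D j * z j); last by ring.
    exact: le_trans (Dz j) dld.
  exists s0 => // s ss ts1; rewrite /phi ptD; apply: Hs => //.
  rewrite -ptD; apply: cpt; move: ss => /andP[ss _]; apply/andP; split; lra.
have close u v : in_cube u -> in_cube v ->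
    (forall j, `|u ord0 j - v ord0 j| <= dl) -> `|f u - f v| <= L * d%:R * eta.
  move=> cu cv uv; apply: le_trans (lip _ _ cu cv) _.
  rewrite -mulrA ler_wpM2l//.
  apply: (@le_trans _ _ (\sum_(j < d) eta)).
    by apply: ler_sum => j _; apply: le_trans (uv j) dle.
  by rewrite sumr_const card_ord mulr_natl.
have c0 : `|phi 0 - f p| <= L * d%:R * eta.
  apply: close => //; first by apply: cpt; rewrite lexx ler01.
  by move=> j; rewrite !mxE mul0r addr0 addrAC subrr add0r.
have c1 : `|phi 1 - f q| <= L * d%:R * eta.
  apply: close => //; first by apply: cpt; rewrite lexx ler01.
  move=> j; rewrite !mxE /h mul1r; have := Dz j.
  by congr (`| _ | <= _); ring.
have : (L' + `|m - eta|) * eta <= (L' + `|m| + 1) * eta.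
  rewrite ler_wpM2r ?(ltW eta0)// -addrA lerD2l.
  by apply: le_trans (ler_normB _ _) _; rewrite lerD2l gtr0_norm.
move: c0 c1; rewrite !ler_norml => /andP[c01 c02] /andP[c11 c12].
have -> : M * eta = eta + (L' + `|m| + 1) * eta + 2 * (L * d%:R * eta).
  by rewrite /M; ring.
lra.
Qed.

End line_increment.

(** * Copulas and their derivatives *)

Section cube_null.
Context {R : realType} {d : nat}.

Lemma lebesgue_outer_ge0 (A : set 'rV[R]_d) : (0 <= lebesgue_outer A)%E.
Proof.
apply: le_ereal_inf_tmp => _ [p [lp _] <-]; apply: nneseries_ge0 => k _ _.
rewrite lee_fin; apply: prodr_ge0 => j _; rewrite subr_ge0.
by have /forallP := lp k; apply.
Qed.

Lemma lebesgue_outer_cube : (0 < d)%N ->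
  (lebesgue_outer (in_cube : set 'rV[R]_d) <= 1)%E.
Proof.
move=> d0.
pose p (k : nat) : 'rV[R]_d * 'rV[R]_d :=
  (0, if k == 0%N then const_mx 1 else 0).
apply: (@le_trans _ _
    (\sum_(0 <= k <oo) (\prod_j ((p k).2 ord0 j - (p k).1 ord0 j))%:E)%E).
  apply: ereal_inf_lbound; exists p => //; split.
    by move=> k; apply/forallP => j; rewrite /p /=; case: ifP; rewrite !mxE ?ler01.
  by move=> x cx; exists 0%N => // j; rewrite /p /= !mxE; exact: cx.
rewrite (nneseries_split 0 1)//; last first.
  move=> k _; rewrite lee_fin; apply: prodr_ge0 => j _.
  by rewrite /p /=; case: ifP; rewrite !mxE ?subrr// subr0 ler01.
rewrite eseries0 ?adde0.
  rewrite add0n big_nat1 /p /= lee_fin big1// => j _.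
  by rewrite !mxE subr0.
(* The remaining boxes are single points; their volume is 0 because the product has at least one
   factor. *)
move=> k k1 _; rewrite /p /= gtn_eqF//.
by rewrite (bigD1 (Ordinal d0))//= !mxE subr0 mul0r.
Qed.

(** Measurability of [S] splits the cube additively, and a cube of outer measure at most 1 leaves
    nothing for the complement. *)
Lemma lebesgue_outer_cubeD (S : set 'rV[R]_d) : (0 < d)%N -> S `<=` in_cube ->
  lebesgue_outer.-caratheodory S -> lebesgue_outer S = 1%E ->
  lebesgue_outer (in_cube `\` S) = 0%E.
Proof.
move=> d0 Scube mS S1; apply/eqP; rewrite eq_le lebesgue_outer_ge0 andbT.
have := mS in_cube; rewrite (setIidr Scube) S1 -setDE.
have := lebesgue_outer_cube d0; move=> /[swap] ->.
by rewrite -[leRHS]adde0 leeD2lE.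
Qed.

End cube_null.

Section hybrid.
Context {R : realType} {d : nat}.
Implicit Types x y : 'rV[R]_d.

(* The path from [x] to [y] that changes one coordinate at a time. *)
Definition hybrid (k : nat) x y : 'rV[R]_d :=
  \row_j (if (j < k)%N then y ord0 j else x ord0 j).

Lemma hybridS (k : 'I_d) x y :
  hybrid k.+1 x y = subst_coord (hybrid k x y) k (y ord0 k).
Proof.
apply/rowP => j; rewrite !mxE ltnS leq_eqVlt -val_eqE /=.
by case: eqP => [/val_inj ->|].
Qed.

Lemma hybrid_diag (k : 'I_d) x y : hybrid k x y ord0 k = x ord0 k.
Proof. by rewrite mxE ltnn. Qed.

Lemma hybrid_increments (f : 'rV[R]_d -> R) x y (c e : 'I_d -> R) :
  (forall k : 'I_d,
    `|f (hybrid k.+1 x y) - f (hybrid k x y) - c k| <= e k) ->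
  `|f y - f x - \sum_k c k| <= \sum_k e k.
Proof.
move=> H.
have -> : f y - f x = \sum_(k < d) (f (hybrid k.+1 x y) - f (hybrid k x y)).
  rewrite -(big_mkord xpredT (fun k => f (hybrid k.+1 x y) - f (hybrid k x y))).
  rewrite telescope_sumr//; congr (f _ - f _).
    by apply/rowP => j; rewrite mxE ltn_ord.
  by apply/rowP => j; rewrite mxE.
rewrite -sumrB; apply: le_trans (ler_norm_sum _ _ _) _.
by apply: ler_sum => k _; exact: H.
Qed.

Lemma in_cube_hybrid k x y : in_cube x -> in_cube y -> in_cube (hybrid k x y).
Proof. by move=> cx cy j; rewrite mxE; case: ifP. Qed.

End hybrid.

Section copula_lipschitz.
Context {R : realType} {d : nat} (C : 'rV[R]_d -> R).
Hypothesis copulaC : is_copula C.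
Implicit Types u v : 'rV[R]_d.

Let mbelow (u : 'rV[R]_d) :
  measurable [set v : d.-tuple R | forall j, tnth v j <= u ord0 j].
Proof.
apply: (measurable_forall_ord (P := fun j (v : d.-tuple R) => tnth v j <= u ord0 j)).
by move=> j; apply: measurable_fun_ler => //; exact: measurable_tnth.
Qed.

Let mcoord (j : 'I_d) (t : R) : measurable [set v : d.-tuple R | tnth v j <= t].
Proof.
rewrite -[X in measurable X]setTI.
have := @measurable_fun_ler _ (d.-tuple R) R setT (fun w : d.-tuple R => tnth w j) (cst t)
  (@measurable_tnth _ _ _ j) (@measurable_cst _ _ _ _ _ _) measurableT [set true].
by apply.
Qed.

Lemma copula_itv u : in_cube u -> 0 <= C u <= 1.
Proof.
case: copulaC => Q [_ QC] /QC E; rewrite -!lee_fin -E.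
by rewrite measure_ge0 probability_le1.
Qed.

Lemma copula_le_coord u (j : 'I_d) : in_cube u -> C u <= u ord0 j.
Proof.
case: copulaC => Q [Qm QC] cu; rewrite -lee_fin -(QC _ cu) -(Qm j _ (cu j)).
by apply: le_measure; rewrite ?inE// => v /=; apply.
Qed.

(** The orthant below [v] is covered by the orthant below [u] and a slab in direction [j], whose
    mass is its width because the margins are uniform. *)
Lemma copula_monoS u v (j : 'I_d) : in_cube u -> in_cube v ->
  u ord0 j <= v ord0 j -> (forall k, k != j -> u ord0 k = v ord0 k) ->
  0 <= C v - C u <= v ord0 j - u ord0 j.
Proof.
case: copulaC => Q [Qm QC] cu cv uv E.
have uv' k : u ord0 k <= v ord0 k.
  by have [->//|kj] := eqVneq k j; rewrite E.
rewrite subr_ge0 -lee_fin -(QC _ cu) -(QC _ cv); apply/andP; split.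
  apply: le_measure; rewrite ?inE// => w /= wu k.
  exact: le_trans (wu k) (uv' k).
rewrite lerBlDr -lee_fin -(QC _ cv).
pose B := [set w : d.-tuple R | tnth w j <= v ord0 j] `\`
          [set w | tnth w j <= u ord0 j].
have mB : measurable B by exact: measurableD.
have QB : Q B = (v ord0 j - u ord0 j)%:E.
  rewrite measureD//; last by rewrite ltey_eq fin_num_measure.
  rewrite setIidr; last by move=> w /= /le_trans; apply.
  by rewrite [X in (X - _)%E](Qm j _ (cv j)) [X in (_ - X)%E](Qm j _ (cu j)).
rewrite EFinD -QB -(QC _ cu).
apply: le_trans (measureU2 _ mB (mbelow u)).
apply: le_measure; rewrite ?inE//; first exact: measurableU.
move=> w /= wv; have [wu|wu] := leP (tnth w j) (u ord0 j).
  by right => k; have [->//|kj] := eqVneq k j; rewrite E.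
by left; split; [exact: wv|apply/negP; rewrite -ltNge].
Qed.

Lemma in_cube_subst u j t : in_cube u -> 0 <= t <= 1 -> in_cube (subst_coord u j t).
Proof. by move=> cu t01 k; rewrite mxE; case: ifP. Qed.

Lemma copula_subst u j t : in_cube u -> 0 <= t <= 1 ->
  `|C (subst_coord u j t) - C u| <= `|t - u ord0 j|.
Proof.
move=> cu t01; have cs := in_cube_subst j cu t01.
have E k : k != j -> u ord0 k = subst_coord u j t ord0 k.
  by rewrite mxE => /negbTE ->.
have Ej : subst_coord u j t ord0 j = t by rewrite mxE eqxx.
have [ut|/ltW ut] := leP (u ord0 j) t.
  have := copula_monoS (j := j) cu cs; rewrite Ej => /(_ ut E) /andP[h0 h1].
  by rewrite !ger0_norm// subr_ge0.
have := copula_monoS (j := j) cs cu; rewrite Ej => /(_ ut).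
move=> /(_ (fun k kj => esym (E k kj))) /andP[h0 h1].
by rewrite distrC (distrC t) !ger0_norm// subr_ge0.
Qed.

Lemma copula_lipschitz u v : in_cube u -> in_cube v ->
  `|C u - C v| <= \sum_j `|u ord0 j - v ord0 j|.
Proof.
move=> cu cv; have := @hybrid_increments _ _ C v u (fun=> 0)
  (fun j => `|u ord0 j - v ord0 j|).
rewrite big1// subr0; apply => k; rewrite subr0 hybridS.
by have := copula_subst k (in_cube_hybrid k cv cu) (cu k); rewrite hybrid_diag.
Qed.

(** [C] equals 1 at the upper corner, since almost surely all coordinates are at most 1. Raising the
    coordinate from [t] to 1 adds at most [1 - t], which gives the lower bound; the margin gives the
    upper one. *)
Lemma copula_margin (j : 'I_d) t : 0 <= t <= 1 ->
  C (subst_coord (const_mx 1) j t) = t.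
Proof.
move=> t01; have c1 : in_cube (const_mx 1 : 'rV[R]_d).
  by move=> k; rewrite mxE ler01 lexx.
have cs := in_cube_subst j c1 t01.
have C1 : C (const_mx 1) = 1.
  case: copulaC => Q [Qm QC]; apply/EFin_inj; rewrite -QC//.
  have : {ae Q, forall v : d.-tuple R, forall k, tnth v k <= 1}.
    apply: filter_forall => k; exists (~` [set v : d.-tuple R | tnth v k <= 1]).
    split => //; first exact: measurableC.
    by rewrite probability_setC// Qm ?ler01 ?lexx// subee.
  rewrite /almost_everywhere /prop_near1 /= => /measure_negligible => QN.
  have := mbelow (const_mx 1) => mb.
  rewrite -(setCK [set v : d.-tuple R | _]) probability_setC; last exact: measurableC.
  rewrite (_ : ~` _ = ~` [set v : d.-tuple R | forall k, tnth v k <= 1]).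
    rewrite QN ?sube0//; apply: measurableC; move: mb; congr measurable.
    by apply/seteqP; split => v /= H k; have := H k; rewrite mxE.
  by congr (~` _); apply/seteqP; split => v /= H k; have := H k; rewrite mxE.
apply/eqP; rewrite eq_le; apply/andP; split.
  by have := copula_le_coord j cs; rewrite mxE eqxx.
have := copula_monoS (u := subst_coord (const_mx 1) j t) (j := j) cs c1.
rewrite !mxE eqxx C1 => /(_ _ _)/andP[].
- by case/andP: t01.
- by move=> k /negbTE kj; rewrite !mxE kj.
- lra.
Qed.

End copula_lipschitz.

Section row_ball.
Context {R : realType} {d : nat}.
Implicit Types u v x : 'rV[R]_d.

Lemma row_ballE v r x : 0 < r ->
  ball v r x <-> forall j, `|x ord0 j - v ord0 j| < r.
Proof.
move=> r0; split.
  by move=> [_ H] j; have := H ord0 j; rewrite /ball /= distrC.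
by move=> H; split => // i j; rewrite ord1 /ball /= distrC; exact: H.
Qed.

Lemma row_nbhsP v (A : set 'rV[R]_d) : nbhs v A <-> exists2 r, 0 < r &
  forall x, (forall j, `|x ord0 j - v ord0 j| < r) -> A x.
Proof.
split=> [/nbhs_ballP[r /= r0 rA]|[r r0 rA]].
  by exists r => // x xv; apply: rA; apply/(row_ballE _ _ r0).
apply/nbhs_ballP; exists r => //= x /(row_ballE _ _ r0); exact: rA.
Qed.

End row_ball.

Section strict_derivative.
Context {R : realType} {d : nat} (C : 'rV[R]_d -> R).
Hypothesis copulaC : is_copula C.
Hypothesis null : lebesgue_outer (in_cube `\` smooth_set C) = 0%E.
Implicit Types u v x y p q : 'rV[R]_d.
Local Notation S := (smooth_set C).

Lemma has_partialP v j (eta : R) : has_partial C j v -> 0 < eta ->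
  exists2 r, 0 < r & forall t, 0 <= t <= 1 -> `|t - v ord0 j| < r ->
    `|C (subst_coord v j t) - C v - partial C j v * (t - v ord0 j)| <=
    eta * `|t - v ord0 j|.
Proof.
move=> [cv cvgv] eta0.
have /cvgrPdist_le /(_ _ eta0) := cvgv.
rewrite near_withinE /dnbhs near_withinE near_nbhs => /nbhs_ballP[r /= r0 H].
exists r => // t t01 tr.
have [->|tv] := eqVneq t (v ord0 j).
  rewrite !subrr mulr0 normr0 mulr0 subr0.
  rewrite (_ : subst_coord _ _ _ = v) ?subrr ?normr0//.
  by apply/rowP => k; rewrite mxE; case: eqP => [->|].
have tv0 : t - v ord0 j != 0 by rewrite subr_eq0.
have := H t; rewrite /ball /= distrC => /(_ tr tv); rewrite in_itv /= => /(_ t01).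
rewrite -ler_pdivrMr ?normr_gt0// -normrV ?unitfE// -normrM => H'.
apply: le_trans H'; rewrite [leRHS]distrC /diff_quotient.
rewrite le_eqVlt; apply/orP; left; apply/eqP; congr `| _ |.
by rewrite /partial /diff_quotient; field.
Qed.

Lemma has_partial_lt1 v j : has_partial C j v -> `|partial C j v| <= 1.
Proof.
move=> Hv; apply/ler_addgt0Pr => e e0.
have [r r0 H] := has_partialP Hv e0.
have cv := Hv.1; have /andP[v0 v1] := cv j.
have [t t01 [tr tv]] : exists2 t, 0 <= t <= 1 &
    `|t - v ord0 j| < r /\ t != v ord0 j.
  pose s := Num.min (r / 2) 2^-1.
  have s0 : 0 < s by rewrite lt_min divr_gt0//= invr_gt0.
  have sr : s <= r / 2 by rewrite ge_min lexx.
  have s2 : s <= 2^-1 by rewrite ge_min lexx orbT.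
  (* The test point is taken towards the farther end of [0, 1], so that it stays in the interval. *)
  have [vh|vh] := leP (v ord0 j) (2^-1).
    exists (v ord0 j + s); first by apply/andP; split; lra.
    have E : v ord0 j + s - v ord0 j = s by ring.
    by rewrite -subr_eq0 E gtr0_norm// gt_eqF//; split => //; lra.
  exists (v ord0 j - s); first by apply/andP; split; lra.
  have E : v ord0 j - s - v ord0 j = - s by ring.
  by rewrite -subr_eq0 E normrN gtr0_norm// oppr_eq0 gt_eqF//; split => //; lra.
have n0 : 0 < `|t - v ord0 j| by rewrite normr_gt0 subr_eq0.
rewrite -(ler_pM2r n0) -normrM mulrDl mul1r.
have := H t t01 tr; have := copula_subst copulaC j cv t01.
set a := C _ - C _; set b := partial _ _ _ * _ => h1 h2.
have -> : b = a - (a - b) by ring.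
by apply: le_trans (ler_normB _ _) _; apply: lerD.
Qed.

Lemma smooth_setP v j (eta : R) : S v -> 0 < eta ->
  exists2 r, 0 < r & forall x, S x -> (forall k, `|x ord0 k - v ord0 k| < r) ->
    `|partial C j x - partial C j v| <= eta.
Proof.
move=> [cv /(_ j)[Hv]] /cvgrPdist_le cont eta0.
have := cont _ eta0; rewrite near_withinE near_nbhs => /row_nbhsP[r r0 H].
exists r => // x Sx xv; rewrite distrC; apply: H => //; exact: (Sx.2 j).1.
Qed.

Lemma smooth_partials v (eta : R) : S v -> 0 < eta ->
  exists2 r, 0 < r & forall x, S x -> (forall k, `|x ord0 k - v ord0 k| < r) ->
    forall j, `|partial C j x - partial C j v| <= eta.
Proof.
move=> Sv eta0.
have : forall j : 'I_d, \forall r \near (0 : R)^'+, forall x, S x ->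
    (forall k, `|x ord0 k - v ord0 k| < r) ->
    `|partial C j x - partial C j v| <= eta.
  move=> j; have [r r0 H] := smooth_setP j Sv eta0.
  near=> s => x Sx xv; apply: H => // k; apply: lt_trans (xv k) _.
  near: s; exact: nbhs_right_lt.
move=> /filter_forall H.
near (0 : R)^'+ => r; exists r => //.
move=> x Sx xv j.
have := near H r; apply => //.
Unshelve. all: by end_near. Qed.

(** Without points of the smooth set near [u], the derivative condition of [line_increment] is
    vacuous on the degenerate segment at [u], and the zero function would increase by 1. *)
Lemma smooth_dense u r : in_cube u -> 0 < r ->
  exists2 x, S x & forall j, `|x ord0 j - u ord0 j| < r.
Proof.
move=> cu r0; apply: contrapT => nx.
suff : 1 <= (0 : R) - 0 by rewrite subrr ler10.
apply: (line_increment (f := fun=> 0) (L := 0) (S := S) (p := u) (q := u)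
  (delta := r / 2)) => //.
- by move=> *; rewrite subrr normr0 mul0r.
- by move=> j; rewrite subrr normr0 invr_ge0.
- by rewrite divr_gt0.
- move=> x Sx xu; exfalso; apply: nx; exists x => // j.
  have [t _] := xu j; rewrite subrr mulr0 addr0 => /le_lt_trans; apply.
  by rewrite ltr_pdivrMr// ltr_pMr// ltr1n.
Qed.

(** Along an axis-parallel segment the mere existence of the [j]-th partial derivative at the points
    of [S] gives the derivative that [line_increment] needs, and its continuity at [v] keeps it
    within [eta] of the value there. The signs [1] and [-1] give the two bounds. *)
Lemma strict_partial v j (eta : R) : S v -> 0 < eta ->
  exists2 r, 0 < r & forall x t, in_cube x -> 0 <= t <= 1 ->
    (forall k, `|x ord0 k - v ord0 k| < r) -> `|t - v ord0 j| < r ->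
    `|C (subst_coord x j t) - C x - partial C j v * (t - x ord0 j)| <=
    eta * `|t - x ord0 j|.
Proof.
move=> Sv eta0.
have [r0 r00 Hr0] := smooth_setP j Sv eta0.
(* Points within [r] of the segment are within [2 * r <= r0] of [v], and two coordinates within 1/4
   of that of [v] differ by at most 1/2, as [line_increment] requires. *)
pose r := Num.min (r0 / 2) 4^-1.
have rgt0 : 0 < r by rewrite lt_min divr_gt0//= invr_gt0.
have rr0 : r <= r0 / 2 by rewrite ge_min lexx.
have r4 : r <= 4^-1 by rewrite ge_min lexx orbT.
exists r => // x t cx t01 xv tv.
pose y := subst_coord x j t.
have cy : in_cube y by exact: in_cube_subst.
have yE s z : z + s *: (y - x) = subst_coord z j (z ord0 j + s * (t - x ord0 j)).
  apply/rowP => k; rewrite !mxE; case: eqP => [->//|_].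
  by rewrite subrr mulr0 addr0.
have tx : `|t - x ord0 j| <= 2^-1.
  have -> : t - x ord0 j = (t - v ord0 j) - (x ord0 j - v ord0 j) by ring.
  apply: le_trans (ler_normB _ _) _; have := xv j; lra.
have main (sg : R) : `|sg| = 1 ->
    sg * (partial C j v * (t - x ord0 j)) - eta * `|t - x ord0 j| <=
    sg * C y - sg * C x.
  move=> sg1.
  apply: (line_increment (f := fun x => sg * C x) (L := 1) (S := S) (p := x) (q := y)
    (delta := r)) => //.
  - move=> a b ca cb; rewrite -mulrBr normrM sg1 !mul1r; exact: copula_lipschitz.
  - move=> k; rewrite mxE; case: eqP => [->//|_].
    by rewrite subrr normr0 invr_ge0.
  - move=> z Sz zx e e0.
    have Pz : `|partial C j z - partial C j v| <= eta.
      apply: Hr0 => // k; have [s /andP[s0 s1]] := zx k.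
      rewrite mxE; case: eqP => [->|_] H.
        have -> : z ord0 j - v ord0 j =
          (z ord0 j - (x ord0 j + s * (t - x ord0 j))) +
          (s * (t - v ord0 j) + (1 - s) * (x ord0 j - v ord0 j)) by ring.
        apply: le_lt_trans (ler_normD _ _) _.
        suff : `|s * (t - v ord0 j) + (1 - s) * (x ord0 j - v ord0 j)| < r.
          by move: H; lra.
        apply: le_lt_trans (ler_normD _ _) _.
        rewrite !normrM (ger0_norm s0) (@ger0_norm _ (1 - s)) ?subr_ge0//.
        have xvj := xv j.
        have [->|sn0] := eqVneq s 0; first by lra.
        have sp : 0 < s by rewrite lt_neqAle eq_sym sn0.
        have h1 : s * `|t - v ord0 j| < s * r by rewrite ltr_pM2l.
        have h2 : (1 - s) * `|x ord0 j - v ord0 j| <= (1 - s) * r.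
          by rewrite ler_wpM2l ?subr_ge0// ltW.
        lra.
      move: H; rewrite subrr mulr0 addr0 => H.
      have -> : z ord0 k - v ord0 k =
        (z ord0 k - x ord0 k) + (x ord0 k - v ord0 k) by ring.
      apply: le_lt_trans (ler_normD _ _) _; have := xv k; lra.
    have [s0 s00 Hs0] := has_partialP (Sz.2 j).1 e0.
    exists s0 => // s /andP[sp ss0] cz.
    rewrite yE -mulrBr; set w := subst_coord _ _ _.
    pose h := t - x ord0 j; rewrite -/h.
    have h1 : `|h| <= 1 by apply: le_trans tx _; rewrite invf_le1// ler1n.
    have sh : `|s * h| <= s by rewrite normrM gtr0_norm// ler_piMr// ltW.
    have wz01 : 0 <= z ord0 j + s * h <= 1.
      by have := cz j; rewrite yE mxE eqxx.
    have := Hs0 _ wz01; rewrite [z ord0 j + _]addrC addrK => /(_ (le_lt_trans sh ss0)).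
    rewrite addrC -/w -/h => HC.
    have e1 : e * `|s * h| <= e * s by rewrite ler_wpM2l// ltW.
    have e2 : `|sg * (C w - C z - partial C j z * (s * h))| <= e * s.
      by rewrite normrM sg1 mul1r; apply: le_trans HC e1.
    have e3 : `|sg * ((partial C j z - partial C j v) * (s * h))| <= eta * `|h| * s.
      rewrite !normrM sg1 mul1r (gtr0_norm sp) -mulrA (mulrC s).
      by rewrite ler_wpM2r// mulr_ge0// ltW.
    move: e2 e3; rewrite !ler_norml => /andP[e21 _] /andP[e31 _].
    lra.
have m1 := main 1 (normr1 _).
have m2 := main (-1) (ltac:(by rewrite normrN normr1)).
rewrite ler_norml; apply/andP; split; rewrite -/y; lra.
Qed.

(** The hybrid points between [x] and [y] stay in the same coordinatewise neighbourhood of [v]. None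
    of them need be [v], which is why the partial increments must be controlled strictly, with a
    moving base point. *)
Lemma strict_differential v (eta : R) : S v -> 0 < eta ->
  exists2 r, 0 < r & forall x y, in_cube x -> in_cube y ->
    (forall k, `|x ord0 k - v ord0 k| < r) ->
    (forall k, `|y ord0 k - v ord0 k| < r) ->
    `|C y - C x - \sum_j partial C j v * (y ord0 j - x ord0 j)| <=
    eta * \sum_j `|y ord0 j - x ord0 j|.
Proof.
move=> Sv eta0.
have : forall j : 'I_d, \forall r \near (0 : R)^'+, forall x t,
    in_cube x -> 0 <= t <= 1 ->
    (forall k, `|x ord0 k - v ord0 k| < r) -> `|t - v ord0 j| < r ->
    `|C (subst_coord x j t) - C x - partial C j v * (t - x ord0 j)| <=
    eta * `|t - x ord0 j|.
  move=> j; have [r r0 H] := strict_partial j Sv eta0.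
  near=> s => x t cx t01 xv tv.
  have sr : s < r by near: s; exact: nbhs_right_lt.
  apply: H => // [k|]; [exact: lt_trans (xv k) sr|exact: lt_trans tv sr].
move=> /filter_forall H.
near (0 : R)^'+ => r; exists r => //.
move=> x y cx cy xv yv.
rewrite mulr_sumr; apply: hybrid_increments => k.
have := near H r; rewrite hybridS => /(_ _ k) Hk.
rewrite -{1 2}(hybrid_diag k x y); apply: Hk => //; first exact: in_cube_hybrid.
by move=> i; rewrite mxE; case: ifP.
Unshelve. all: by end_near. Qed.

(** This is the mean value inequality in arbitrary directions: at points of [S] the strict
    differential makes the derivative along [q - p] the gradient sum, so [line_increment] applies to
    [sg * C]. *)
Lemma copula_increment p q (sg c delta : R) : `|sg| = 1 ->
  in_cube p -> in_cube q -> (forall j, `|q ord0 j - p ord0 j| <= 2^-1) ->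
  0 < delta ->
  (forall x, S x ->
     (forall j, exists2 t, 0 <= t <= 1 &
        `|x ord0 j - (p ord0 j + t * (q ord0 j - p ord0 j))| <= delta) ->
     c <= sg * \sum_j partial C j x * (q ord0 j - p ord0 j)) ->
  c <= sg * (C q - C p).
Proof.
move=> sg1 cp cq pq d0 H; rewrite mulrBr.
apply: (line_increment (f := fun x => sg * C x) (L := 1) (S := S) (p := p) (q := q)
    (delta := delta)) => //.
  by move=> a b ca cb; rewrite -mulrBr normrM sg1 !mul1r; exact: copula_lipschitz.
move=> x Sx xpq eta eta0.
pose N := \sum_j `|q ord0 j - p ord0 j|.
have N0 : 0 <= N by exact: sumr_ge0.
have N1 : 0 < 1 + N by rewrite ltr_pwDl.
have [r r0 Hr] := strict_differential Sx (ltac:(by rewrite divr_gt0) : 0 < eta / (1 + N)).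
exists r => // s /andP[s0 sr] cxs.
rewrite -mulrBr.
have := Hr x _ Sx.1 cxs.
have -> : \sum_j `|(x + s *: (q - p)) ord0 j - x ord0 j| = s * N.
  rewrite /N mulr_sumr; apply: eq_bigr => j _.
  by rewrite !mxE addrC addKr normrM gtr0_norm.
have -> : \sum_j partial C j x * ((x + s *: (q - p)) ord0 j - x ord0 j) =
    s * \sum_j partial C j x * (q ord0 j - p ord0 j).
  by rewrite mulr_sumr; apply: eq_bigr => j _; rewrite !mxE; ring.
move=> /(_ _ _) H1.
have {}H1 := H1 (ltac:(by move=> k; rewrite subrr normr0)).
have {}H1 : `|C (x + s *: (q - p)) - C x -
       s * (\sum_j partial C j x * (q ord0 j - p ord0 j))| <= eta * s.
  have xsr k : `|(x + s *: (q - p)) ord0 k - x ord0 k| < r.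
    rewrite !mxE (addrC (x ord0 k)) addrK normrM gtr0_norm//.
    apply: le_lt_trans sr; rewrite ler_piMr// ?ltW//.
    by apply: le_lt_trans (pq k) _; rewrite invf_lt1// ltr1n.
  apply: le_trans (H1 xsr) _.
  rewrite (_ : _ * (s * N) = (eta * s) * (N / (1 + N))); last by ring.
  by rewrite ler_piMr ?mulr_ge0 ?(ltW eta0) ?(ltW s0)// ler_pdivrMr// mul1r lerDr.
have {}H1 : `|sg * (C (x + s *: (q - p)) - C x -
       s * (\sum_j partial C j x * (q ord0 j - p ord0 j)))| <= eta * s.
  by rewrite normrM sg1 mul1r.
have := H x Sx xpq; rewrite -(ler_pM2r s0).
move: H1; rewrite ler_norml => /andP[H1 _]; lra.
Qed.

End strict_derivative.

(** * Fell and hypi convergence *)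

Section fell_convergence.
Context {R : realType} {E : topologicalType}.

(** Painleve-Kuratowski convergence along a filter: the first clause puts [A] inside the lower
    limit, the second puts the upper limit inside [A]. *)
Definition kuratowski {I} (F : set_system I) (A : set E) (B : I -> set E) :=
  (forall G, open G -> A `&` G !=set0 ->
     \forall i \near F, B i `&` G !=set0) /\
  (forall p, ~ A p -> \forall q \near p & i \near F, ~ B i q).

Lemma kuratowski_preimage {I} (F : set_system I) {FF : Filter F} (h : E -> E)
    (A : set E) (B : I -> set E) : continuous h -> involutive h ->
  kuratowski F A B -> kuratowski F (h @^-1` A) (fun i => h @^-1` B i).
Proof.
move=> ch hK [hit miss]; split=> [G oG [x [Ax Gx]]|p Ap].
  have : \forall i \near F, B i `&` h @^-1` G !=set0.
    apply: hit; first by move/continuousP : ch; apply.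
    by exists (h x); split => //=; rewrite hK.
  by apply: filterS => i [y [By Gy]]; exists (h y); split => //=; rewrite hK.
have [[P Q] [nP nQ] PQ] := miss _ Ap.
exists (h @^-1` P, Q); first by split => //; exact: ch.
by move=> [q i] [/= Pq Qi]; exact: (PQ (h q, i)).
Qed.

(** The [dF]-ball around [A] is Fell open, so it contains a basic neighbourhood of [A]. Its finitely
    many hit conditions hold eventually, and compactness makes the pointwise miss condition uniform
    over [K]. *)
Lemma fell_near {I} (F : set_system I) {FF : Filter F}
    (dF : set E -> set E -> R) (A : set E) (B : I -> set E) (e : R) :
  fell_metric dF -> closed A -> (\forall i \near F, closed (B i)) ->
  kuratowski F A B -> 0 < e -> \forall i \near F, dF A (B i) < e.
Proof.
move=> [dF0 dFid dFtri dFopen] cA cB [hit miss] e0.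
pose O := [set D | closed D /\ dF A D < e].
have AA : dF A A = 0 by apply/dFid.
have /(dFopen O) [_ /(_ _)] : O `<=` [set A | closed A] by move=> D [].
move=> /(_ _) fO.
have : fell_open O.
  apply: fO; split; first by move=> D [].
  move=> D [cD ADe]; exists (e - dF A D); first by rewrite subr_gt0.
  move=> D' cD' DD'; split => //; apply: le_lt_trans (dFtri _ D _ _ _ _) _ => //.
  by rewrite -ltrBrDl.
move=> /(_ A) []; first by split => //; rewrite AA.
move=> k [G [K [oG cK [_ AG AK] sub]]].
have nG : \forall i \near F, forall j, B i `&` G j !=set0.
  by apply: filter_forall => j; exact: hit.
have nK : \forall i \near F, K `<=` [set q | ~ B i q].
  move/compact_near_coveringP : cK; apply => x Kx; apply: miss => Ax.
  by have : (A `&` K) x by []; rewrite AK.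
near=> i.
suff /sub[] : fell_basic G K (B i) by [].
split; [by near: i|by near: i|].
apply/seteqP; split => // q [Bq Kq].
by have /(_ q Kq) : K `<=` [set q | ~ B i q] by near: i.
Unshelve. all: by end_near. Qed.

End fell_convergence.

Section sup_inf.
Context {R : realType} {T : Type}.
Variables (B : R -> set T) (f : T -> R) (K : R).
Hypothesis B0 : forall e, 0 < e -> B e !=set0.
Hypothesis fK : forall e y, B e y -> `|f y| <= K.

Let infB e c : 0 < e -> c < inf [set f y | y in B e] -> forall y, B e y -> c < f y.
Proof.
move=> e0 ce y By; apply: lt_le_trans ce _; apply: ge_inf; last by exists y.
by exists (- K) => _ [z /fK + <-]; rewrite ler_norml => /andP[].
Qed.

(** The family [B] is left general to serve both [lower_hull], where it consists of balls, and [dC],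
    where it consists of the nearby points of the smooth set. *)
Lemma sup_inf_gt c : c < sup [set inf [set f y | y in B e] | e in [set e | 0 < e]] ->
  exists2 e, 0 < e & forall y, B e y -> c < f y.
Proof.
move=> /sup_gt[]; first by exists (inf [set f y | y in B 1]); exists 1 => /=.
by move=> _ [e e0 <-] ce; exists e => //; exact: infB.
Qed.

Lemma sup_inf_lt c e :
  sup [set inf [set f y | y in B e] | e in [set e | 0 < e]] < c -> 0 < e ->
  exists2 y, B e y & f y < c.
Proof.
move=> + e0; have [y0 By0] := B0 e0 => supc.
suff /inf_lt[] : inf [set f y | y in B e] < c.
- by exists (f y0); exists y0.
- by move=> _ [y By <-] fc; exists y.
apply: le_lt_trans supc; apply: ub_le_sup; last by exists e.
exists K => _ [r r0 <-]; have [y By] := B0 r0.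
apply: (@le_trans _ _ (f y)); last first.
  by have := fK By; rewrite ler_norml => /andP[].
apply: ge_inf; last by exists y.
by exists (- K) => _ [z /fK + <-]; rewrite ler_norml => /andP[].
Qed.

End sup_inf.

Section hulls.
Context {R : realType} {T : pseudoMetricType R}.
Implicit Types f g : T -> R.

Lemma lower_hull_gt f c x : linf f -> c < lower_hull f x ->
  exists2 e, 0 < e & forall y, ball x e y -> c < f y.
Proof.
by move=> [K fK]; apply: (@sup_inf_gt _ _ (ball x) _ K) => e y _.
Qed.

Lemma lower_hull_lt f c x e : linf f -> lower_hull f x < c -> 0 < e ->
  exists2 y, ball x e y & f y < c.
Proof.
move=> [K fK]; apply: (@sup_inf_lt _ _ (ball x) _ K) => [r r0|r y _]; last exact: fK.
by exists x; exact: ballxx.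
Qed.

Lemma lower_hull_ge f c x e : linf f -> 0 < e ->
  (forall y, ball x e y -> c <= f y) -> c <= lower_hull f x.
Proof.
move=> lf e0 H; rewrite leNgt; apply/negP => /(lower_hull_lt lf) /(_ e0)[y /H].
by rewrite leNgt => /negP.
Qed.

Lemma lower_hull_le f x : linf f -> lower_hull f x <= f x.
Proof.
move=> lf; rewrite leNgt; apply/negP => /(lower_hull_gt lf)[e e0 /(_ x)].
by rewrite ltxx => /(_ (ballxx _ e0)).
Qed.

Lemma upper_hullE f : upper_hull f = \- lower_hull (\- f).
Proof.
apply/funext => x; rewrite /upper_hull /lower_hull /inf /=; congr (- sup _).
rewrite image_comp; apply: eq_imagel => e _ /=; congr (- sup _).
by rewrite image_comp; apply: eq_imagel => y _ /=; rewrite opprK.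
Qed.

Lemma linfN f : linf f -> linf (\- f).
Proof. by move=> [K fK]; exists K => x /=; rewrite normrN. Qed.

Lemma lower_hull_near f c x : linf f -> c < lower_hull f x ->
  \forall y \near x, c <= lower_hull f y.
Proof.
move=> lf /(lower_hull_gt lf)[e e0 He]; apply/nbhs_ballP.
exists (e / 2); first by rewrite /= divr_gt0.
move=> y xy; apply: (lower_hull_ge (e := e / 2) lf); first by rewrite divr_gt0.
by move=> z yz; apply/ltW/He/(ball_split xy yz).
Qed.

Lemma near_snd_lt (p : T * R) c : p.2 < c -> \forall q \near p, q.2 < c.
Proof.
move=> pc; exists (setT, [set t | t < c]); last by move=> q [].
by split; [exact: filterT|exact: lt_nbhsl].
Qed.

Lemma near_fst (p : T * R) (P : set T) :
  nbhs p.1 P -> \forall q \near p, P q.1.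
Proof.
by move=> nP; exists (P, setT); [split => //; exact: filterT|move=> q []].
Qed.

Lemma closed_epi f : linf f -> closed (epi (lower_hull f)).
Proof.
move=> lf; rewrite -[epi _]setCK; apply: open_closedC; rewrite openE => p /=.
rewrite /epi /= => /negP; rewrite -ltNge => pf.
pose c := (p.2 + lower_hull f p.1) / 2.
have [pc cf] : p.2 < c /\ c < lower_hull f p.1 by rewrite /c; split; lra.
have nf : \forall q \near p, c <= lower_hull f q.1.
  apply: (near_fst (P := [set x | c <= lower_hull f x])).
  exact: lower_hull_near.
rewrite /interior /=; near=> q; apply/negP; rewrite -ltNge.
apply: (@lt_le_trans _ _ c); near: q => //; exact: near_snd_lt.
Unshelve. all: by end_near. Qed.

Definition reflect_snd (p : T * R) : T * R := (p.1, - p.2).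

Lemma reflect_sndK : involutive reflect_snd.
Proof. by move=> [x y]; rewrite /reflect_snd /= opprK. Qed.

Lemma continuous_reflect_snd : continuous reflect_snd.
Proof.
move=> p A [[P Q] [nP nQ] PQ]; exists (P, -%R @^-1` Q).
  by split => //; exact: (@opp_continuous R p.2 Q nQ).
by move=> q [Pq Qq]; exact: (PQ (q.1, - q.2)).
Qed.

Lemma hypo_upper_hull f :
  hypo (upper_hull f) = reflect_snd @^-1` epi (lower_hull (\- f)).
Proof.
rewrite upper_hullE; apply/seteqP; split => p; rewrite /hypo /epi /=.
  by rewrite lerNr.
by rewrite lerNr.
Qed.

Lemma closed_hypo f : linf f -> closed (hypo (upper_hull f)).
Proof.
move=> lf; rewrite hypo_upper_hull.
have := continuous_reflect_snd => /continuous_closedP; apply.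
exact/closed_epi/linfN.
Qed.

(** The hulls of the [g i] can be avoided: a value of [g i] lies above its hull, which suffices for
    hitting, and a lower bound for [g i] on a ball passes to the hull on the ball of half the
    radius. *)
Lemma epi_kuratowski {I} (F : set_system I) {FF : Filter F} f (g : I -> T -> R) :
  linf f -> (\forall i \near F, linf (g i)) ->
  (forall x c r, lower_hull f x < c -> 0 < r ->
     \forall i \near F, exists2 y, ball x r y & g i y < c) ->
  (forall x c, c < lower_hull f x ->
     exists2 r, 0 < r & \forall i \near F, forall y, ball x r y -> c <= g i y) ->
  kuratowski F (epi (lower_hull f)) (fun i => epi (lower_hull (g i))).
Proof.
move=> lf lg hit miss; split=> [G oG [[x y] [/= fxy Gxy]]|[x y] fxy].
  have [[P Q] [/nbhs_ballP[r r0 rP] /nbhs_ballP[s s0 sQ]] PQ] :=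
    open_nbhs_nbhs (conj oG Gxy).
  have s20 : 0 < s / 2 by rewrite divr_gt0.
  have yxs : lower_hull f x < y + s / 2.
    by move: fxy; rewrite /epi /=; lra.
  have := hit x _ r yxs r0; apply: filterS2 lg => i li [x' xx' gx'].
  exists (x', y + s / 2); split.
    by rewrite /epi /=; apply: le_trans (lower_hull_le _ li) (ltW gx').
  apply: PQ; split; first exact: rP.
  apply: sQ; rewrite /ball /= opprD addrA subrr add0r normrN gtr0_norm//.
  by rewrite ltr_pdivrMr// ltr_pMr// ltr1n.
move: fxy; rewrite /epi /= => /negP; rewrite -ltNge => yf.
pose c := (y + lower_hull f x) / 2.
have [yc cf] : y < c /\ c < lower_hull f x by rewrite /c; split; lra.
have [r r0 Hr] := miss x c cf.
have r20 : 0 < r / 2 by rewrite divr_gt0.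
have n1 : \forall q \near (x, y), ball x (r / 2) q.1 /\ q.2 < c.
  apply: filterI; last exact: near_snd_lt.
  by apply: (near_fst (P := ball x (r / 2))); apply/nbhs_ballP; exists (r / 2).
have n2 : \forall i \near F, linf (g i) /\ forall y, ball x r y -> c <= g i y.
  by apply: filterS2 lg Hr.
exists ([set q | ball x (r / 2) q.1 /\ q.2 < c],
  [set i | linf (g i) /\ forall y, ball x r y -> c <= g i y]) => //.
move=> [q i] [/= [xq qc] [li Hi]]; rewrite /epi /=; apply/negP; rewrite -ltNge.
apply: lt_le_trans qc _; apply: (lower_hull_ge (e := r / 2)) => // z qz.
by apply/Hi/(ball_split xq qz).
Qed.

Section hypi_dist.
Variable dF : set (T * R) -> set (T * R) -> R.
Hypothesis dF_fell : fell_metric dF.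

(** Reflection of the second coordinate turns hypographs into epigraphs of the opposite functions,
    so both halves of the distance are handled by epigraphs. *)
Lemma hypi_dist_near {I} (F : set_system I) {FF : Filter F} f (g : I -> T -> R) e :
  linf f -> (\forall i \near F, linf (g i)) -> 0 < e ->
  kuratowski F (epi (lower_hull f)) (fun i => epi (lower_hull (g i))) ->
  kuratowski F (epi (lower_hull (\- f))) (fun i => epi (lower_hull (\- g i))) ->
  \forall i \near F, hypi_dist dF f (g i) < e.
Proof.
move=> lf lg e0 kf kNf.
have h1 : \forall i \near F,
    dF (epi (lower_hull f)) (epi (lower_hull (g i))) < e.
  apply: fell_near => //; first exact: closed_epi.
  by apply: filterS lg => i; exact: closed_epi.
have h2 : \forall i \near F,
    dF (hypo (upper_hull f)) (hypo (upper_hull (g i))) < e.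
  apply: fell_near => //; first exact: closed_hypo.
    by apply: filterS lg => i; exact: closed_hypo.
  rewrite hypo_upper_hull.
  have -> : (fun i => hypo (upper_hull (g i))) =
      (fun i => reflect_snd @^-1` epi (lower_hull (\- g i))).
    by apply: funext => i; exact: hypo_upper_hull.
  by apply: kuratowski_preimage kNf; [exact: continuous_reflect_snd|
    exact: reflect_sndK].
by apply: filterS2 h1 h2 => i; rewrite /hypi_dist gt_max => -> ->.
Qed.

Lemma hypi_dist_refl f : linf f -> hypi_dist dF f f = 0.
Proof.
move=> lf; case: dF_fell => _ dFid _ _; rewrite /hypi_dist.
have -> : dF (epi (lower_hull f)) (epi (lower_hull f)) = 0.
  by apply/dFid => //; exact: closed_epi.
have -> : dF (hypo (upper_hull f)) (hypo (upper_hull f)) = 0.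
  by apply/dFid => //; exact: closed_hypo.
by rewrite maxxx.
Qed.

Lemma hypi_dist_sym f g : linf f -> linf g -> hypi_dist dF f g = hypi_dist dF g f.
Proof.
move=> lf lg; case: dF_fell => dF0 _ _ _; rewrite /hypi_dist; congr Num.max.
  by have [] := dF0 _ _ (closed_epi lf) (closed_epi lg).
by have [] := dF0 _ _ (closed_hypo lf) (closed_hypo lg).
Qed.

Lemma hypi_dist_triangle f g h : linf f -> linf g -> linf h ->
  hypi_dist dF f h <= hypi_dist dF f g + hypi_dist dF g h.
Proof.
move=> lf lg lh; case: dF_fell => _ _ tri _; rewrite /hypi_dist ge_max.
apply/andP; split.
  apply: le_trans (tri _ _ _ (closed_epi lf) (closed_epi lg) (closed_epi lh)) _.
  by apply: lerD; rewrite le_max lexx.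
apply: le_trans (tri _ _ _ (closed_hypo lf) (closed_hypo lg) (closed_hypo lh)) _.
by apply: lerD; rewrite le_max lexx orbT.
Qed.

Lemma hypi_class_refl f : linf f -> hypi_class dF f f.
Proof. by move=> lf; split => //; exact: hypi_dist_refl. Qed.

Lemma Linf_distE f g : linf f -> linf g ->
  Linf_dist dF (hypi_class dF f) (hypi_class dF g) = hypi_dist dF f g.
Proof.
move=> lf lg; rewrite /Linf_dist.
have := @getPex _ (hypi_class dF f) (ex_intro _ _ (hypi_class_refl lf)).
set f' := get _ => -[lf' ff'].
have := @getPex _ (hypi_class dF g) (ex_intro _ _ (hypi_class_refl lg)).
set g' := get _ => -[lg' gg'].
apply/eqP; rewrite eq_le; apply/andP; split.
  apply: le_trans (hypi_dist_triangle (g := f) lf' lf lg') _.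
  rewrite hypi_dist_sym// ff' add0r.
  by apply: le_trans (hypi_dist_triangle (g := g) lf lg lg') _; rewrite gg' addr0.
apply: le_trans (hypi_dist_triangle (g := f') lf lf' lg) _; rewrite ff' add0r.
apply: le_trans (hypi_dist_triangle (g := g') lf' lg' lg) _.
by rewrite (hypi_dist_sym lg' lg) gg' addr0.
Qed.

Lemma uniform_epi_kuratowski {I} (F : set_system I) {FF : Filter F}
    f (g : I -> T -> R) :
  linf f -> (\forall i \near F, linf (g i)) ->
  (forall r, 0 < r -> \forall i \near F, forall x, `|g i x - f x| <= r) ->
  kuratowski F (epi (lower_hull f)) (fun i => epi (lower_hull (g i))).
Proof.
move=> lf lg H; apply: epi_kuratowski => //.
  move=> x c r /(lower_hull_lt lf) /[apply] -[y xy fc].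
  have /H : 0 < (c - f y) / 2 by rewrite divr_gt0// subr_gt0.
  apply: filterS => i /(_ y); rewrite ler_norml => /andP[_ h].
  by exists y => //; lra.
move=> x c cf; pose c' := (c + lower_hull f x) / 2.
have [cc' c'f] : c < c' /\ c' < lower_hull f x by rewrite /c'; split; lra.
have [e e0 He] := lower_hull_gt lf c'f; exists e => //.
have /H : 0 < c' - c by rewrite subr_gt0.
apply: filterS => i Hi y /He fy; have := Hi y; rewrite ler_norml => /andP[h _].
lra.
Qed.

(** Uniform convergence is stronger than hypi convergence; this serves the Borel measurability of
    the limit. *)
Lemma uniform_hypi_dist {I} (F : set_system I) {FF : Filter F}
    f (g : I -> T -> R) e :
  linf f -> (\forall i \near F, linf (g i)) -> 0 < e ->
  (forall r, 0 < r -> \forall i \near F, forall x, `|g i x - f x| <= r) ->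
  \forall i \near F, hypi_dist dF f (g i) < e.
Proof.
move=> lf lg e0 H; apply: hypi_dist_near => //.
  exact: uniform_epi_kuratowski.
apply: uniform_epi_kuratowski; first exact: linfN.
  by apply: filterS lg => i; exact: linfN.
move=> r /H; apply: filterS => i Hi x.
by rewrite /= -opprD normrN.
Qed.

End hypi_dist.

End hulls.

(** * Weak convergence *)

Section weak_convergence_lemmas.
Context {R : realType}.

Lemma bounded_integrable {dsp} {Om : measurableType dsp} (P : probability Om R)
    (Z : Om -> R) (K : R) : measurable_fun setT Z -> (forall w, `|Z w| <= K) ->
  P.-integrable setT (EFin \o Z).
Proof.
move=> mZ ZK; apply: measurable_bounded_integrable => //.
  by rewrite -ge0_fin_numE// fin_num_measure.
exists K; split; first exact: num_real.
by move=> x Kx w _; apply: le_trans (ZK w) (ltW Kx).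
Qed.

Lemma outer_expectation_le {dsp} {Om : measurableType dsp}
    (P : probability Om R) (Z Z' : Om -> R) : (forall w, Z w <= Z' w) ->
  (outer_expectation P Z <= outer_expectation P Z')%E.
Proof.
move=> ZZ'; apply: le_ereal_inf => _ [Y [mY Z'Y EY] <-]; exists Y => //.
by split => // w; apply: le_trans (Z'Y w); rewrite lee_fin.
Qed.

Context {E : Type} (M : set E) (dist : E -> E -> R).

Lemma borel_measurable_comp {dsp} {Om : measurableType dsp} (X : Om -> E)
    (h : E -> R) : borel_measurable M dist X -> bounded_continuous M dist h ->
  measurable_fun setT (h \o X).
Proof.
move=> [MX mX] [_ ch].
apply: (measurability _ (RGenOInfty.measurableE R)) => _ [_ [c ->] <-].
rewrite setTI.
have -> : (h \o X) @^-1` `]c, +oo[%classic = X @^-1` [set x | M x /\ c < h x].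
  apply/seteqP; split => w /=; rewrite in_itv /= andbT; first by split.
  by case.
apply: mX; apply: sub_sigma_algebra; split; first by move=> x [].
move=> x [Mx cx]; have [r r0 Hr] := ch x Mx (h x - c) (ltac:(by rewrite subr_gt0)).
exists r => // y My xy; split => //; have := Hr y My xy.
by rewrite ltr_norml => /andP[]; lra.
Qed.

Lemma borel_measurableP {dsp} {Om : measurableType dsp} (X : Om -> E) :
  (forall w, M (X w)) ->
  (forall O, dist_open M dist O -> measurable (X @^-1` O)) ->
  borel_measurable M dist X.
Proof.
move=> MX mO; split => // B sB.
have : sigma_algebra M [set B : set E | measurable (X @^-1` B)].
  split.
  - by rewrite /= preimage_set0.
  - move=> A /= mA; rewrite (_ : _ @^-1` _ = ~` (X @^-1` A)); first exact: measurableC.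
    by apply/seteqP; split => w /=; [case|move=> ?; split].
  - by move=> A mA; rewrite /= preimage_bigcup; exact: bigcupT_measurable.
move=> sig; have := sB [set B : set E | measurable (X @^-1` B)]; apply.
by split.
Qed.

Lemma bounded_continuousN (h : E -> R) : bounded_continuous M dist h ->
  bounded_continuous M dist (\- h).
Proof.
move=> [[K hK] ch]; split; first by exists K => x Mx /=; rewrite normrN hK.
move=> x Mx e e0; have [r r0 Hr] := ch x Mx e e0; exists r => // y My xy /=.
by rewrite -opprD normrN; exact: Hr.
Qed.

Hypothesis dist_ge0 : forall x y, M x -> M y -> 0 <= dist x y.
Hypothesis distxx : forall x, M x -> dist x x = 0.
Hypothesis dist_sym : forall x y, M x -> M y -> dist x y = dist y x.
Hypothesis dist_triangle : forall x y z, M x -> M y -> M z ->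
  dist x z <= dist x y + dist y z.

Section penalization.
Context {dsp} {Om : measurableType dsp} (P : probability Om R)
  {dsp'} {Om' : measurableType dsp'} (P' : probability Om' R)
  (Xn : nat -> Om -> E) (X : Om' -> E)
  (Hn : nat -> Om -> R) (H : Om' -> R) (K : R).
Hypothesis MXn : forall n w, M (Xn n w).
Hypothesis bX : borel_measurable M dist X.
Hypothesis HnK : forall n w, `|Hn n w| <= K.
Hypothesis HK : forall w, `|H w| <= K.
Hypothesis mH : measurable_fun setT H.
Hypothesis cont : {ae P', forall w', forall e, 0 < e ->
  exists2 delta, 0 < delta & exists m, forall n w, (m <= n)%N ->
    dist (Xn n w) (X w') < delta -> `|Hn n w - H w'| < e}.

(* [phi m] is an [m]-Lipschitz majorant of all [Hn n] with [m <= n], and it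
   decreases to [H] as [m] grows; this replaces the portmanteau theorem. *)
Let pset m x := [set r | r = - K \/ exists n w, (m <= n)%N /\
  r = Hn n w - m%:R * dist (Xn n w) x].

Let phi m x := sup (pset m x).

Let pset_ubound m x : M x -> ubound (pset m x) K.
Proof.
move=> Mx r [->|[n [w [_ ->]]]].
  by have := HK point; have := normr_ge0 (H point); lra.
have := HnK n w; rewrite ler_norml => /andP[_ h].
have : 0 <= m%:R * dist (Xn n w) x by rewrite mulr_ge0// dist_ge0.
lra.
Qed.

Let phi_bound m x : M x -> `|phi m x| <= K.
Proof.
move=> Mx; rewrite ler_norml; apply/andP; split.
  by apply: ub_le_sup; [exists K; exact: pset_ubound|left].
by apply: ge_sup; [exists (- K); left|exact: pset_ubound].
Qed.

Let phi_lip m x y : M x -> M y -> phi m x <= phi m y + m%:R * dist x y.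
Proof.
move=> Mx My; have hy : has_ubound (pset m y) by exists K; exact: pset_ubound.
have d0 : 0 <= m%:R * dist x y by rewrite mulr_ge0// dist_ge0.
apply: ge_sup; first by exists (- K); left.
move=> r [->|[n [w [mn ->]]]].
  by apply: ler_wpDr => //; apply: ub_le_sup => //; left.
have h : Hn n w - m%:R * dist (Xn n w) y <= phi m y.
  by apply: ub_le_sup => //; right; exists n, w.
have := dist_triangle (MXn n w) Mx My.
move=> /(ler_wpM2l (ler0n R m)); lra.
Qed.

Let phi_bc m : bounded_continuous M dist (phi m).
Proof.
split; first by exists K => x; exact: phi_bound.
move=> x Mx e e0; exists (e / m.+1%:R); first by rewrite divr_gt0.
move=> y My; rewrite ltr_pdivlMr// mulrC => xy.
have h1 := phi_lip m Mx My; have h2 := phi_lip m My Mx.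
rewrite (dist_sym My Mx) in h2.
have : m%:R * dist x y < e.
  by apply: le_lt_trans xy; rewrite ler_wpM2r ?dist_ge0// ler_nat.
by rewrite ltr_norml => ?; apply/andP; split; lra.
Qed.

Let phi_ge m n w : (m <= n)%N -> Hn n w <= phi m (Xn n w).
Proof.
move=> mn; apply: ub_le_sup; first by exists K; exact: pset_ubound.
by right; exists n, w; rewrite distxx// mulr0 subr0.
Qed.

Let phi_lim : {ae P', forall w', forall e, 0 < e -> \forall m \near \oo,
  phi m (X w') <= H w' + e}.
Proof.
apply: filterS cont => w' Hw' e e0.
have [delta d0 [m0 Hm0]] := Hw' e e0.
near=> m.
have hK := HK w'; have /andP[hK1 hK2] : - K <= H w' <= K by rewrite -ler_norml.
apply: ge_sup; first by exists (- K); left.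
move=> r [->|[n [w [mn ->]]]]; first lra.
have mm0 : (m0 <= m)%N by near: m; exact: nbhs_infty_ge.
have dd := dist_ge0 (MXn n w) (bX.1 w').
have [dl|dl] := ltP (dist (Xn n w) (X w')) delta.
  have := Hm0 n w (leq_trans mm0 mn) dl; rewrite ltr_norml => /andP[_ h].
  have : 0 <= m%:R * dist (Xn n w) (X w') by rewrite mulr_ge0.
  lra.
(* Far from [X w'] the penalty is at least [2 * K], which brings the term below [- K]. *)
have md : (2 * K) / delta <= m%:R by near: m; exact: nbhs_infty_ger.
have : 2 * K <= m%:R * dist (Xn n w) (X w').
  apply: (@le_trans _ _ (m%:R * delta)); first by rewrite -ler_pdivrMr.
  by rewrite ler_wpM2l.
have := HnK n w; rewrite ler_norml => /andP[_ h].
lra.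
Unshelve. all: by end_near. Qed.

Lemma penalization e : 0 < e -> exists2 h : E -> R, bounded_continuous M dist h &
  (\forall n \near \oo, forall w, Hn n w <= h (Xn n w)) /\
  (\int[P']_w (h (X w))%:E <= \int[P']_w (H w)%:E + e%:E)%E.
Proof.
(* [phi_lim] only bounds [phi m (X w)] from above in the limit; the maximum with [H] turns this into
   the convergence that dominated convergence asks for. *)
move=> e0; pose g m w := Num.max (phi m (X w)) (H w).
have mphi m : measurable_fun setT (fun w => phi m (X w)).
  exact: (borel_measurable_comp bX (phi_bc m)).
have mg m : measurable_fun setT (g m).
  by apply: measurable_maxr => //; exact: mphi.
have gK m w : `|g m w| <= K.
  have := HK w; have := phi_bound m (bX.1 w); rewrite /g /Num.max.
  by case: ifP.
have [//|||||_ _ gint] := @dominated_convergence _ _ _ P' setT measurableT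
    (fun m => EFin \o g m) (EFin \o H) (cst K%:E).
- by move=> m; apply/measurable_EFinP.
- exact/measurable_EFinP.
- apply: filterS phi_lim => w Hw _.
  apply/fine_cvgP; split; first by apply: nearW.
  apply/cvgrPdist_le => r r0; near=> m.
  rewrite /= distrC ger0_norm ?subr_ge0 ?le_max ?lexx ?orbT//.
  rewrite lerBlDr addrC /g ge_max lerDl (ltW r0) andbT.
  by near: m; exact: Hw.
- have K0 : 0 <= K by apply: le_trans (HK point).
  by apply: (@bounded_integrable _ _ _ (cst K) K) => // w; rewrite ger0_norm.
- by apply: nearW => w m _; rewrite /= lee_fin.
have fH : (\int[P']_w (H w)%:E)%E \is a fin_num.
  by apply: integrable_fin_num => //; exact: bounded_integrable HK.
have : \forall m \near \oo, (\int[P']_w (g m w)%:E < \int[P']_w (H w)%:E + e%:E)%E.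
  apply: (gint [set y | (y < \int[P']_w (H w)%:E + e%:E)%E]).
  apply: open_nbhs_nbhs; split; first exact: open_ereal_lt_ereal.
  by rewrite /= lteDl.
move=> [m _ Hm]; have {}Hm := Hm m (leqnn m).
exists (phi m); first exact: phi_bc.
split; first by exists m => // n mn w; exact: phi_ge.
apply: le_trans (ltW Hm); apply: le_integral => //.
- by apply: (@bounded_integrable _ _ _ _ K) => // w; exact/phi_bound/bX.1.
- exact: bounded_integrable (gK m).
- by move=> w _; rewrite lee_fin le_max lexx.
Unshelve. all: by end_near. Qed.

End penalization.

(** Outer expectation is not odd, so the lower bound is not the negated upper bound. Penalizing
    [- Hn] yields a continuous minorant [- h] of [Hn], to which weak convergence applies in its own
    right. *)
Lemma extended_continuous_mapping
    {dsp} {Om : measurableType dsp} (P : probability Om R)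
    {dsp'} {Om' : measurableType dsp'} (P' : probability Om' R)
    (Xn : nat -> Om -> E) (X : Om' -> E)
    (Hn : nat -> Om -> R) (H : Om' -> R) (K : R) :
  weakly_converges M dist P Xn P' X ->
  (forall n w, `|Hn n w| <= K) -> (forall w, `|H w| <= K) ->
  measurable_fun setT H ->
  {ae P', forall w', forall e, 0 < e ->
    exists2 delta, 0 < delta & exists m, forall n w, (m <= n)%N ->
      dist (Xn n w) (X w') < delta -> `|Hn n w - H w'| < e} ->
  outer_expectation P (Hn n) @[n --> \oo] --> (\int[P']_w (H w)%:E)%E.
Proof.
move=> [MXn bX wc] HnK HK mH cont.
have iH : P'.-integrable setT (EFin \o H) by exact: bounded_integrable HK.
have fH : (\int[P']_w (H w)%:E)%E \is a fin_num by exact: integrable_fin_num.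
have upper e : 0 < e -> \forall n \near \oo,
    (outer_expectation P (Hn n) < \int[P']_w (H w)%:E + e%:E)%E.
  move=> e0; have e20 : 0 < e / 2 by rewrite divr_gt0.
  have [h bh [Hh ih]] := penalization MXn bX HnK HK mH cont e20.
  have lt1 : (\int[P']_w (h (X w))%:E < \int[P']_w (H w)%:E + e%:E)%E.
    apply: le_lt_trans ih _; rewrite lteD2lE// lte_fin.
    by rewrite ltr_pdivrMr// ltr_pMr// ltr1n.
  have : \forall n \near \oo, (outer_expectation P (fun w => h (Xn n w)) <
      \int[P']_w (H w)%:E + e%:E)%E.
    apply: (wc h bh [set y | (y < \int[P']_w (H w)%:E + e%:E)%E]).
    by apply: open_nbhs_nbhs; split => //; exact: open_ereal_lt_ereal.
  apply: filterS2 Hh => n Hn'; apply: le_lt_trans.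
  exact: outer_expectation_le.
have lower e : 0 < e -> \forall n \near \oo,
    (\int[P']_w (H w)%:E - e%:E < outer_expectation P (Hn n))%E.
  move=> e0; have e20 : 0 < e / 2 by rewrite divr_gt0.
  have HnKN n w : `|- Hn n w| <= K by rewrite normrN.
  have HKN w : `|- H w| <= K by rewrite normrN.
  have mHN : measurable_fun setT (fun w => - H w) by exact: measurableT_comp.
  have contN : {ae P', forall w', forall e, 0 < e ->
    exists2 delta, 0 < delta & exists m, forall n w, (m <= n)%N ->
      dist (Xn n w) (X w') < delta -> `|- Hn n w - - H w'| < e}.
    apply: filterS cont => w' + r r0 => /(_ r r0)[delta d0 [m Hm]].
    exists delta => //; exists m => n w mn d; rewrite -opprD normrN.
    exact: Hm.
  have [h bh [Hh ih]] := penalization MXn bX HnKN HKN mHN contN e20.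
  have bhN := bounded_continuousN bh.
  have lt1 : (\int[P']_w (H w)%:E - e%:E < \int[P']_w (- h (X w))%:E)%E.
    have eN (Z : Om' -> R) : P'.-integrable setT (EFin \o Z) ->
       (\int[P']_w (- Z w)%:E = - \int[P']_w (Z w)%:E)%E.
      move=> iZ; under eq_integral do rewrite EFinN.
      by rewrite integralN//=; exact: integrable_add_def.
    have ihX : P'.-integrable setT (EFin \o (h \o X)).
      have [K' hK'] := bh.1; apply: (@bounded_integrable _ _ _ _ K').
        exact: borel_measurable_comp bX bh.
      by move=> w; apply: hK'; exact: bX.1.
    rewrite (eN (h \o X))//; rewrite eN// in ih.
    have fh : (\int[P']_w (h (X w))%:E)%E \is a fin_num.
      exact: (@integrable_fin_num _ _ _ _ _ _ (EFin \o (h \o X))).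
    move: ih fh fH; case: (\int[P']_w (h (X w))%:E)%E => // a.
    case: (\int[P']_w (H w)%:E)%E => // b.
    rewrite -EFinN -EFinD lee_fin -EFinN -EFinD lte_fin => ? _ _.
    by lra.
  have : \forall n \near \oo, (\int[P']_w (H w)%:E - e%:E <
      outer_expectation P (fun w => - h (Xn n w))%R)%E.
    apply: (wc _ bhN [set y | (\int[P']_w (H w)%:E - e%:E < y)%E]).
    by apply: open_nbhs_nbhs; split => //; exact: open_ereal_gt_ereal.
  apply: filterS2 Hh => n Hn' /lt_le_trans; apply.
  by apply: outer_expectation_le => w /=; rewrite lerNl.
move: fH upper lower; case: (\int[P']_w (H w)%:E)%E => // a _ upper lower.
have fin : \forall n \near \oo, outer_expectation P (Hn n) \is a fin_num.
  apply: filterS2 (upper 1 ltr01) (lower 1 ltr01) => n.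
  by case: (outer_expectation P (Hn n)).
apply/fine_cvgP; split => //.
apply/cvgrPdist_lt => e e0.
apply: filterS3 fin (upper e e0) (lower e e0) => n /=.
case: (outer_expectation P (Hn n)) => // r _.
rewrite -EFinB -EFinD !lte_fin /= => h1 h2.
by rewrite ltr_norml; apply/andP; split; lra.
Qed.

End weak_convergence_lemmas.

Section sup_distance.
Context {R : realType} {T : pseudoMetricType R}.
Implicit Types f g h : T -> R.

Lemma sup_dist_ub f g x : linf f -> linf g -> `|f x - g x| <= sup_dist f g.
Proof.
move=> [K fK] [L gL]; apply: ub_le_sup; last by exists x.
exists (K + L) => _ [y _ <-]; apply: le_trans (ler_normB _ _) _.
exact: lerD.
Qed.

Lemma sup_dist_le f g c : 0 <= c -> (forall x, `|f x - g x| <= c) ->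
  sup_dist f g <= c.
Proof.
move=> c0 H; rewrite /sup_dist.
have [[x Tx]|T0] := pselect ([set `|f x - g x| | x in [set: T]] !=set0).
  by apply: ge_sup; [exists x|move=> _ [y _ <-]].
have -> : [set `|f x - g x| | x in [set: T]] = set0.
  by apply/seteqP; split => // y Hy; apply: T0; exists y.
by rewrite sup0.
Qed.

Lemma sup_dist_ge0 f g : linf f -> linf g -> 0 <= sup_dist f g.
Proof.
move=> lf lg; rewrite /sup_dist.
have [[_ [x _ _]]|T0] := pselect ([set `|f x - g x| | x in [set: T]] !=set0).
  exact: le_trans (sup_dist_ub x lf lg).
have -> : [set `|f x - g x| | x in [set: T]] = set0.
  by apply/seteqP; split => // y Hy; apply: T0; exists y.
by rewrite sup0.
Qed.

Lemma sup_distxx f : sup_dist f f = 0.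
Proof.
rewrite /sup_dist.
have [[_ [x _ _]]|T0] := pselect ([set `|f x - f x| | x in [set: T]] !=set0).
  rewrite [X in sup X](_ : _ = [set 0]) ?sup1//.
  apply/seteqP; split => [_ [y _ <-]|_ ->] /=; first by rewrite subrr normr0.
  by exists x => //; rewrite subrr normr0.
have -> : [set `|f x - f x| | x in [set: T]] = set0.
  by apply/seteqP; split => // y Hy; apply: T0; exists y.
by rewrite sup0.
Qed.

Lemma sup_dist_sym f g : sup_dist f g = sup_dist g f.
Proof.
by rewrite /sup_dist; congr sup; apply: eq_imagel => x _; rewrite distrC.
Qed.

Lemma sup_dist_triangle f g h : linf f -> linf g -> linf h ->
  sup_dist f h <= sup_dist f g + sup_dist g h.
Proof.
move=> lf lg lh; apply: sup_dist_le.
  by rewrite addr_ge0// sup_dist_ge0.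
move=> x; rewrite -(subrKA (g x)).
apply: le_trans (ler_normD _ _) _.
by apply: lerD; exact: sup_dist_ub.
Qed.

(** The functional [Num.min 1 |f t|] is bounded and continuous, and its outer expectation vanishes
    along the sequence, hence its expectation vanishes in the limit. *)
Lemma weak_limit_eq0 {dsp} {Om : measurableType dsp} (P : probability Om R)
    {dsp'} {Om' : measurableType dsp'} (P' : probability Om' R)
    (Xn : nat -> Om -> T -> R) (X : Om' -> T -> R) (t : T) :
  weakly_converges linf sup_dist P Xn P' X ->
  (forall n, {ae P, forall w, Xn n w t = 0}) -> {ae P', forall w, X w t = 0}.
Proof.
move=> [lXn bX wc] Xn0.
pose h (f : T -> R) := Num.min 1 `|f t|.
have h01 f : 0 <= h f <= 1 by rewrite le_min ler01 normr_ge0 ge_min lexx.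
have bh : bounded_continuous linf sup_dist h.
  split.
    by exists 1 => f _; have /andP[h0 h1] := h01 f; rewrite ger0_norm.
  move=> f lf e e0; exists e => // g lg fg.
  have := sup_dist_ub t lg lf; rewrite sup_dist_sym => /le_lt_trans /(_ fg) d.
  apply: le_lt_trans d; rewrite /h.
  apply: (@le_trans _ _ `| `|g t| - `|f t| |); last exact: ler_dist_dist.
  move: `|g t| `|f t| => a b; rewrite /Num.min.
  case: (ltP 1 a) => h1; case: (ltP 1 b) => h2; rewrite ?subrr ?normr0//.
    by rewrite (@ger0_norm _ (1 - b)) ?(@ger0_norm _ (a - b)); lra.
  by rewrite (@ler0_norm _ (a - 1)) ?(@ler0_norm _ (a - b)); lra.
have E0 n : outer_expectation P (fun w => h (Xn n w)) = 0%E.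
  apply/eqP; rewrite eq_le; apply/andP; split; last first.
    apply: le_ereal_inf_tmp => _ [Y [mY hY _] <-].
    apply: integral_ge0 => w _; apply: le_trans (hY w).
    by rewrite lee_fin; case/andP: (h01 (Xn n w)).
  have [N [mN PN NX]] := Xn0 n.
  (* Since [h] is at most 1, the indicator of the null set [N] is a measurable majorant. *)
  apply: ereal_inf_lbound; exists (EFin \o \1_N); last first.
    by rewrite integral_indic// setIT.
  split.
  - exact/measurable_EFinP.
  - move=> w /=; rewrite lee_fin indicE.
    have [wN|wN] := pselect (N w).
      by rewrite mem_set//=; case/andP: (h01 (Xn n w)).
    rewrite memNset//= /h (_ : Xn n w t = 0) ?normr0 ?ge_min ?lexx ?orbT//.
    by apply: contrapT => /(NX w).
  - right; rewrite (eq_integral (cst 0%E)) ?integral0// => w _.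
    by rewrite funenegE /= max_r.
have I0 : (\int[P']_w (h (X w))%:E)%E = 0%E.
  have := wc h bh; rewrite (_ : (fun n => _) = cst 0%E); last first.
    by apply/funext => n; rewrite E0.
  move=> h1; have h2 : (cst 0%E : nat -> \bar R) x @[x --> \oo] --> (0 : \bar R)%E.
    exact: cvg_cst.
  exact: (cvg_unique _ h1 h2).
have mhX : measurable_fun setT (EFin \o (h \o X)).
  by apply/measurable_EFinP; exact: borel_measurable_comp bX bh.
have /(ae_eq_integral_abs P' measurableT mhX) : (\int[P']_w `|(EFin \o (h \o X)) w| = 0)%E.
  rewrite -[RHS]I0; apply: eq_integral => w _ /=.
  by rewrite ger0_norm//; case/andP: (h01 (X w)).
apply: filterS => w /(_ I) /= [] /eqP; rewrite /h /Num.min; case: ltP => _.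
  by rewrite oner_eq0.
by rewrite normr_eq0 => /eqP.
Qed.

End sup_distance.

(** * Empirical quantiles *)

Section empirical_quantile.
Context {R : realType} (n : nat) (z : 'I_n -> R).

Local Notation Fz := (fun t : R => n%:R^-1 * \sum_(i < n) (z i <= t)%R%:R : R).

(** For the value [q] of the generalized inverse these are the quantile inequalities, the left limit
    at [q] being at most [u] and the value at [q] at least [u]. With finitely many observations
    one-sided limits are reached at points close enough to [q]. *)
Lemma gen_inverse_empirical (u : R) : (0 < n)%N -> 0 <= u <= 1 ->
  u <= Fz (gen_inverse Fz u) /\
  n%:R^-1 * \sum_(i < n) (z i < gen_inverse Fz u)%R%:R <= u.
Proof.
move=> n0 /andP[u0 u1].
have nR : 0 < n%:R :> R by rewrite ltr0n.
have nV : 0 < n%:R^-1 :> R by rewrite invr_gt0.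
pose N := \sum_(i < n) `|z i|.
have zN i : `|z i| <= N.
  by rewrite /N (bigD1 i)//= lerDl sumr_ge0.
have Flow t : t < - N -> Fz t = 0.
  move=> tN; rewrite big1 ?mulr0// => i _.
  rewrite leNgt (_ : t < z i)//; apply: lt_le_trans tN _.
  by rewrite lerNl; apply: le_trans (zN i); rewrite -normrN ler_norm.
have Fhigh : Fz N = 1.
  rewrite (eq_bigr (fun=> 1)) ?sumr_const ?card_ord ?mulVf ?gt_eqF//.
  by move=> i _; rewrite (le_trans (ler_norm _) (zN i)).
have Fge0 t : 0 <= Fz t.
  by rewrite mulr_ge0 ?(ltW nV)// sumr_ge0.
rewrite /gen_inverse; case: eqP => [->|/eqP un0].
  split; first exact: Fge0.
  rewrite big1 ?mulr0// => i _.
  set q := sup _; case: (ltP (z i) q) => // /sup_gt[].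
    by exists (- N - 1); apply: Flow; lra.
  move=> t /= Ft zt; have : 0 < Fz t.
    rewrite mulr_gt0// (bigD1 i)//= (ltW zt) ltr_pwDl//.
    by rewrite sumr_ge0.
  by rewrite Ft ltxx.
have ugt0 : 0 < u by rewrite lt_neqAle eq_sym un0.
set q := inf _; have S0 : [set t | u <= Fz t] !=set0 by exists N; rewrite /= Fhigh.
have Slb : has_lbound [set t | u <= Fz t].
  exists (- N) => t /= ut; rewrite leNgt; apply/negP => /Flow Ft.
  by move: ut; rewrite Ft leNgt ugt0.
split.
  (* No observation lies in []q, t]] for [t] close to [q], so the count at [t] is already the count
     at [q]. *)
  have nt : \forall t \near q^'+, forall i, q < z i -> t < z i.
    apply: filter_forall => i; have [qz|zq] := ltP q (z i).
      by apply: filterS (nbhs_right_lt qz).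
    by apply: nearW.
  near q^'+ => t0.
  have qt0 : q < t0 by [].
  have ht0 : forall i, q < z i -> t0 < z i by near: t0.
  have [y /= uy yt0] := inf_lt S0 qt0.
  apply: le_trans uy _; rewrite ler_wpM2l ?(ltW nV)// ler_sum// => i _.
  rewrite ler_nat; case: (leP (z i) y) => // zy; case: (leP (z i) q) => // /ht0.
  by rewrite ltNge (le_trans zy (ltW yt0)).
have nt : \forall t \near q^'-, forall i, z i < q -> z i <= t.
  apply: filter_forall => i; have [zq|qz] := ltP (z i) q.
    by apply: filterS (nbhs_left_ge zq) => t + _.
  by apply: nearW.
near q^'- => t1.
have qt1 : t1 < q by [].
have ht1 : forall i, z i < q -> z i <= t1 by near: t1.
have : Fz t1 < u.
  rewrite ltNge; apply/negP => ut1.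
  by have := ge_inf Slb ut1; rewrite leNgt -/q qt1.
move=> /ltW; apply: le_trans.
rewrite ler_wpM2l ?(ltW nV)// ler_sum// => i _.
by rewrite ler_nat; case: (ltP (z i) q) => // /ht1 ->.
Unshelve. all: by end_near. Qed.

End empirical_quantile.

Section cube_points.
Context {R : realType} {d : nat}.
Implicit Types u v : 'rV[R]_d.

Definition tocube u : cube R d := insubd cube1 u.

Lemma tocubeK u : in_cube u -> val (tocube u) = u.
Proof. by move=> cu; rewrite insubdK//; exact: mem_set. Qed.

Lemma in_cubeP (u : cube R d) : in_cube (val u).
Proof. exact: set_valP. Qed.

Lemma cube_ballE (u v : cube R d) r : 0 < r ->
  ball u r v <-> forall j, `|val v ord0 j - val u ord0 j| < r.
Proof. by move=> r0; rewrite -row_ballE. Qed.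

Lemma compact_cube : compact (in_cube : set 'rV[R]_d).
Proof.
have -> : (in_cube : set 'rV[R]_d) = [set v | forall j, `[0, 1]%classic (v ord0 j)].
  by apply/seteqP; split => v H j; have := H j; rewrite /= in_itv.
by apply: (@rV_compact R d (fun=> `[0, 1]%classic)) => j; exact: segment_compact.
Qed.

Lemma cube_unif_continuous (x : cube R d -> R) (eta : R) :
  continuous x -> 0 < eta ->
  exists2 r, 0 < r & forall u v : cube R d,
    (forall j, `|val u ord0 j - val v ord0 j| < r) -> `|x u - x v| <= eta.
Proof.
move=> cx eta0.
have : \forall r \near (0 : R)^'+, in_cube `<=` [set w : 'rV[R]_d |
    forall u v : cube R d, val v = w ->
    (forall j, `|val u ord0 j - val v ord0 j| < r) -> `|x u - x v| <= eta].
  have /compact_near_coveringP := compact_cube; apply => w cw.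
  have /cvgrPdist_lt /(_ (eta / 2)) := cx (tocube w).
  rewrite divr_gt0// => /(_ isT) /nbhs_ballP[r /= r0 Hr].
  have Hr' (v : cube R d) : (forall j, `|val v ord0 j - w ord0 j| < r) ->
      `|x (tocube w) - x v| < eta / 2.
    by move=> vw; apply: Hr; apply/(cube_ballE _ _ r0); rewrite tocubeK.
  have r20 : 0 < r / 2 by rewrite divr_gt0.
  exists (ball w (r / 2), [set s | 0 < s < r / 2]).
    split; first by apply/nbhs_ballP; exists (r / 2).
    by near=> s => /=; apply/andP; split => //; near: s; exact: nbhs_right_lt.
  move=> [w' s] [/= /(row_ballE _ _ r20) ww' /andP[s0 sr]] u v vw uv.
  have vwr j : `|val v ord0 j - w ord0 j| < r / 2 by move: (ww' j); rewrite -vw.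
  have h1 := Hr' v; have h2 := Hr' u.
  have {}h1 : `|x (tocube w) - x v| < eta / 2.
    by apply: h1 => j; apply: lt_trans (vwr j) _; lra.
  have {}h2 : `|x (tocube w) - x u| < eta / 2.
    apply: h2 => j; rewrite -(subrKA (val v ord0 j)).
    by apply: le_lt_trans (ler_normD _ _) _; have := uv j; have := vwr j; lra.
  rewrite -(subrKA (x (tocube w))); apply: le_trans (ler_normD _ _) _.
  by rewrite (distrC (x u)); lra.
move=> nr; near (0 : R)^'+ => r; exists r => // u v uv.
have : in_cube `<=` [set w : 'rV[R]_d |
    forall u v : cube R d, val v = w ->
    (forall j, `|val u ord0 j - val v ord0 j| < r) -> `|x u - x v| <= eta].
  by near: r.
by move=> /(_ _ (in_cubeP v)); apply.
Unshelve. all: by end_near. Qed.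

End cube_points.

Section empirical_copula_expansion.
Context {R : realType} {d : nat} {dsp : measure_display}
  {Om : measurableType dsp} (P : probability Om R)
  (X : nat -> {RV P >-> d.-tuple R}).
Implicit Types (u v y : 'rV[R]_d) (w : Om).

Lemma measurable_coord_le i (j : 'I_d) (t : R) :
  measurable [set w | tnth (X i w) j <= t].
Proof.
rewrite -[X in measurable X]setTI.
have := @measurable_fun_ler _ Om R setT (fun w => tnth (X i w) j) (cst t)
  (measurableT_comp (@measurable_tnth _ _ _ j) (@measurable_funPT _ _ _ _ (X i)))
  (@measurable_cst _ _ _ _ _ _) measurableT [set true].
by apply.
Qed.

Lemma marginal_df_homo (j : 'I_d) : {homo marginal_df X j : s t / s <= t}.
Proof.
move=> s t st; apply: fine_le; rewrite ?fin_num_measure//;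
  try exact: measurable_coord_le.
apply: le_measure; rewrite ?inE; try exact: measurable_coord_le.
by move=> w /=/le_trans; apply.
Qed.

Lemma marginal_df_itv (j : 'I_d) t : 0 <= marginal_df X j t <= 1.
Proof.
rewrite /marginal_df fine_ge0//= -lee_fin fineK; last first.
  by rewrite fin_num_measure//; exact: measurable_coord_le.
by apply: probability_le1; exact: measurable_coord_le.
Qed.

Lemma emp_uniform_margin n w j t :
  emp_uniform_df X n w (subst_coord (const_mx 1) j t) =
  n%:R^-1 * \sum_(i < n) (marginal_df X j (tnth (X i w) j) <= t)%R%:R.
Proof.
congr (_ * _); apply: eq_bigr => i _; congr (_%:R); congr nat_of_bool.
apply/forallP/idP => [/(_ j)|H k]; first by rewrite mxE eqxx.
rewrite !mxE; case: eqP => [->//|_].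
by have /andP[] := marginal_df_itv k (tnth (X i w) k).
Qed.

(* The generalized inverses of the margins of [emp_uniform_df], reached through
   those of the empirical margins of the original sample. *)
Definition uniform_quantile n w u : 'rV[R]_d :=
  \row_j marginal_df X j (gen_inverse (emp_marginal_df X n w j) (u ord0 j)).

Lemma in_cube_uniform_quantile n w u : in_cube (uniform_quantile n w u).
Proof. by move=> j; rewrite mxE marginal_df_itv. Qed.

Lemma emp_uniform_df_homo n w u v : (forall j, u ord0 j <= v ord0 j) ->
  emp_uniform_df X n w u <= emp_uniform_df X n w v.
Proof.
move=> uv; rewrite ler_wpM2l ?invr_ge0// ler_sum// => i _; rewrite ler_nat.
case: forallP => // H; case: forallP => // -[] j.
exact: le_trans (H j) (uv j).
Qed.

Lemma emp_copula_le n w u :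
  emp_copula X n w u <= emp_uniform_df X n w (uniform_quantile n w u).
Proof.
rewrite /emp_copula /emp_df ler_wpM2l ?invr_ge0// ler_sum// => i _; rewrite ler_nat.
case: forallP => // H; case: forallP => // -[] j.
by rewrite mxE; apply: marginal_df_homo; have := H j; rewrite mxE.
Qed.

(* Ties among the transformed observations do not matter: strict inequality of
   the images under a margin reflects to the observations. *)
Lemma emp_copula_ge n w u v :
  (forall j, v ord0 j < uniform_quantile n w u ord0 j) ->
  emp_uniform_df X n w v <= emp_copula X n w u.
Proof.
move=> vu; rewrite /emp_copula /emp_df ler_wpM2l ?invr_ge0// ler_sum// => i _.
rewrite ler_nat; case: forallP => // H; case: forallP => // -[] j.
rewrite mxE leNgt; apply/negP => /ltW /(@marginal_df_homo j) h.
have := vu j; rewrite mxE => /lt_le_trans/(_ h); apply/negP; rewrite -leNgt.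
exact: H.
Qed.

Lemma emp_copula_ge0 n w u : 0 <= emp_copula X n w u.
Proof. by rewrite /emp_copula /emp_df mulr_ge0 ?invr_ge0// sumr_ge0. Qed.

Lemma emp_copula_le1 n w u : emp_copula X n w u <= 1.
Proof.
rewrite /emp_copula /emp_df; case: n => [|n]; first by rewrite big_ord0 mulr0.
rewrite mulrC ler_pdivrMr// mul1r -[leRHS](_ : \sum_(i < n.+1) 1 = _).
  by apply: ler_sum => i _; rewrite lern1; case: forallP.
by rewrite sumr_const card_ord.
Qed.

Lemma uniform_quantile_ge n w u j : (0 < n)%N -> in_cube u ->
  u ord0 j <=
  emp_uniform_df X n w (subst_coord (const_mx 1) j (uniform_quantile n w u ord0 j)).
Proof.
move=> n0 cu; rewrite emp_uniform_margin mxE.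
have [+ _] := gen_inverse_empirical (fun i : 'I_n => tnth (X i w) j) n0 (cu j).
move=> /le_trans; apply; rewrite ler_wpM2l ?invr_ge0// ler_sum// => i _.
rewrite ler_nat; case: (leP (tnth (X i w) j)) => // /marginal_df_homo -> //.
Qed.

(** By monotonicity of the margin, an observation whose image is at most [t], hence below the image
    of the quantile, lies strictly below the quantile. *)
Lemma uniform_quantile_le n w u j t : (0 < n)%N -> in_cube u ->
  t < uniform_quantile n w u ord0 j ->
  emp_uniform_df X n w (subst_coord (const_mx 1) j t) <= u ord0 j.
Proof.
move=> n0 cu; rewrite emp_uniform_margin mxE => tq.
have [_] := gen_inverse_empirical (fun i : 'I_n => tnth (X i w) j) n0 (cu j).
apply: le_trans; rewrite ler_wpM2l ?invr_ge0// ler_sum// => i _.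
rewrite ler_nat; case: (leP (marginal_df X j _) t) => // Ft.
rewrite ltNge; case: leP => // /(@marginal_df_homo j) h.
by move: tq; rewrite ltNge (le_trans h Ft).
Qed.

Variable C : 'rV[R]_d -> R.
Hypothesis copulaC : is_copula C.

(** The witness is [uniform_quantile]. Writing [G] as [C] plus the process divided by [s] turns the
    quantile inequalities into bounds on [s * (y j - u j)] with error [3 * eta]; replacing [y] by
    [u] in the argument of [x] costs one more [eta]. *)
Lemma empirical_copula_expansion (x : cube R d -> R) (eta : R) :
  continuous x -> linf x -> (forall j, margin x j 0 = 0) -> 0 < eta ->
  exists m, forall n w, (m <= n)%N ->
    (forall v : cube R d, `|empirical_process X C n w v - x v| < eta) ->
  forall u : cube R d, exists2 y, in_cube y &
    (forall j, `|Num.sqrt n%:R * (y ord0 j - val u ord0 j) +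
       margin x j (val u ord0 j)| <= 4 * eta) /\
    `|empirical_copula_process X C n w u -
      (x u + Num.sqrt n%:R * (C y - C (val u)))| <= 4 * eta.
Proof.
move=> cx [B xB] x0 eta0.
have [r r0 Hr] := cube_unif_continuous cx eta0.
have B0 : 0 <= B by apply: le_trans (xB cube1).
(* Once [s > K], the bound [B + 3 * eta] on [s * |y j - u j|] forces [|y j - u j| < r], the modulus
   of continuity of [x]. *)
pose K := (B + 3 * eta + 1) / r.
have K0 : 0 <= K by rewrite divr_ge0 ?(ltW r0)//; lra.
have [m _ Hm] : \forall n \near \oo, K ^+ 2 < n%:R :> R by exact: nbhs_infty_gtr.
exists m => n w mn close u.
have {}Hm := Hm n mn.
set s := Num.sqrt n%:R.
have sK : K < s.
  by rewrite -(ger0_norm K0) -sqrtr_sqr ltr_sqrt//; apply: le_lt_trans Hm; exact: sqr_ge0.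
have s0 : 0 < s by exact: le_lt_trans K0 sK.
have n0 : (0 < n)%N by rewrite lt0n; apply: contraTneq s0 => n00; rewrite /s n00 sqrtr0 ltxx.
set a := empirical_process X C n w in close.
pose G v := emp_uniform_df X n w v.
have sG v : in_cube v -> s * G v = s * C v + a (tocube v).
  by move=> cv; rewrite /a /empirical_process tocubeK// -/s -/(G v); ring.
have ax (v : cube R d) : x v - eta <= a v <= x v + eta.
  by have := close v; rewrite ltr_norml => /andP[? ?]; apply/andP; split; lra.
have cu := in_cubeP u.
have c1 : in_cube (const_mx 1 : 'rV[R]_d).
  by move=> j; rewrite mxE ler01 lexx.
pose y := uniform_quantile n w (val u).
have cy : in_cube y by exact: in_cube_uniform_quantile.
have sGm j t : 0 <= t <= 1 ->
    s * G (subst_coord (const_mx 1) j t) =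
    s * t + a (tocube (subst_coord (const_mx 1) j t)).
  move=> t01; rewrite sG ?copula_margin//; exact: in_cube_subst.
pose e1 j t : cube R d := tocube (subst_coord (const_mx 1) j t).
have e1E j t : 0 <= t <= 1 -> val (e1 j t) = subst_coord (const_mx 1) j t.
  by move=> t01; rewrite tocubeK//; exact: in_cube_subst.
have Hr1 j t t' : 0 <= t <= 1 -> 0 <= t' <= 1 -> `|t - t'| < r ->
    `|x (e1 j t) - x (e1 j t')| <= eta.
  move=> t01 t'01 tt'; apply: Hr => k; rewrite !e1E// !mxE.
  by case: eqP => // _; rewrite subrr normr0.
have q_lo j : - x (e1 j (y ord0 j)) - eta <= s * (y ord0 j - val u ord0 j).
  have := uniform_quantile_ge w j n0 cu; rewrite -/y -/(G _).
  move=> /(ler_wpM2l (ltW s0)); rewrite sGm// -/(e1 _ _).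
  have /andP[_] := ax (e1 j (y ord0 j)); lra.
have q_hi j : s * (y ord0 j - val u ord0 j) <= - x (e1 j (y ord0 j)) + 3 * eta.
  have /andP[y0 y1] := cy j; have /andP[u0 u1] := cu j.
  (* At [y j = 0] there is no room on the left for the quantile inequality; the vanishing of [x] on
     the null face replaces it. *)
  move: y0; rewrite le_eqVlt => /predU1P[y0|y0].
    have -> : x (e1 j (y ord0 j)) = 0 by rewrite -y0; exact: x0.
    have : 0 <= s * val u ord0 j by rewrite mulr_ge0// ltW.
    by rewrite -y0; lra.
  (* The three [eta] are the shift [s * tau], the oscillation of [x] over it, and the distance from
     [a] to [x]. *)
  pose tau := Num.min (y ord0 j) (Num.min (r / 2) (eta / s)).
  have tau0 : 0 < tau by rewrite !lt_min y0 !divr_gt0.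
  have tauy : tau <= y ord0 j by rewrite ge_min lexx.
  have taur : tau <= r / 2 by rewrite !ge_min lexx orbT.
  have taus : s * tau <= eta.
    by rewrite mulrC -ler_pdivlMr// !ge_min lexx !orbT.
  have t01 : 0 <= y ord0 j - tau <= 1 by apply/andP; split; lra.
  have ty : y ord0 j - tau < y ord0 j by lra.
  have := uniform_quantile_le n0 cu ty; rewrite -/(G _).
  move=> /(ler_wpM2l (ltW s0)); rewrite sGm// -/(e1 _ _).
  have /andP[+ _] := ax (e1 j (y ord0 j - tau)).
  have := Hr1 j _ _ t01 (cy j); rewrite (_ : _ - tau - _ = - tau); last by ring.
  rewrite normrN gtr0_norm// => /(_ (ltac:(lra))).
  rewrite ler_norml => /andP[]; lra.
have yu j : `|y ord0 j - val u ord0 j| < r.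
  rewrite -(ltr_pM2l s0) -{1}(gtr0_norm s0) -normrM.
  have hB : K * r < s * r by rewrite ltr_pM2r.
  have KE : K * r = B + 3 * eta + 1 by rewrite /K mulfVK// gt_eqF.
  have := xB (e1 j (y ord0 j)); rewrite ler_norml => /andP[xB1 xB2].
  have := q_lo j; have := q_hi j => h1 h2.
  by rewrite ltr_norml; apply/andP; split; lra.
have xyu : `|x (tocube y) - x u| <= eta.
  by apply: Hr => j; rewrite tocubeK.
exists y => //; split.
  move=> j; rewrite /margin -/(tocube _) -/(e1 _ _).
  have := Hr1 j _ _ (cy j) (cu j) (yu j).
  have := q_lo j; have := q_hi j => h1 h2.
  rewrite !ler_norml => /andP[h3 h4]; apply/andP; split; lra.
rewrite /empirical_copula_process -/s.
have Cn_hi : s * emp_copula X n w (val u) <= s * C y + a (tocube y).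
  by rewrite -sG// ler_pM2l//; exact: emp_copula_le.
have Cn_lo : s * C y + x (tocube y) - 3 * eta <= s * emp_copula X n w (val u).
  (* On a null face [C y = 0], and [s * G y] is at most the value of [a] on that face, hence at most
     [eta]. So [x] is at most [2 * eta] at [y], and nonnegativity of the empirical copula
     suffices. *)
  have [[j yj0]|ypos] := pselect (exists j, y ord0 j = 0).
    have Cy : C y = 0.
      have := copula_le_coord copulaC j cy; rewrite yj0 => Cy0.
      by apply/eqP; rewrite eq_le Cy0; case/andP: (copula_itv copulaC cy).
    have h1 : s * G y <= s * G (subst_coord (const_mx 1) j 0).
      rewrite ler_pM2l//; apply: emp_uniform_df_homo => k.
      rewrite !mxE; case: eqP => [->|_]; last by have /andP[] := cy k; rewrite mxE.
      by have := yj0; rewrite /y mxE => ->.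
    have z01 : 0 <= (0 : R) <= 1 by rewrite lexx ler01.
    move: h1; rewrite sG// sGm// Cy !mulr0 !add0r.
    have /andP[_] := ax (tocube (subst_coord (const_mx 1) j 0)).
    have -> : x (tocube (subst_coord (const_mx 1) j 0)) = 0 by exact: x0.
    have /andP[+ _] := ax (tocube y).
    have : 0 <= s * emp_copula X n w (val u).
      by rewrite mulr_ge0 ?emp_copula_ge0// ltW.
    lra.
  (* Lowering every coordinate by [tau] changes [s * C] by at most [s * d * tau]; the added 1 keeps
     the divisor positive. *)
  pose s' := s * d%:R + 1.
  have s'0 : 0 < s' by rewrite ltr_wpDl// mulr_ge0// ltW.
  have ypos' j : 0 < y ord0 j.
    have /andP[y0 _] := cy j; rewrite lt_neqAle y0 andbT eq_sym.
    by apply/eqP => yj; apply: ypos; exists j.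
  have : \forall tau \near (0 : R)^'+, forall j, tau < y ord0 j.
    by apply: filter_forall => j; exact: nbhs_right_lt.
  move=> ntau; near (0 : R)^'+ => tau.
  have tau0 : 0 < tau by [].
  have tauy : forall j, tau < y ord0 j by near: tau.
  have taur : tau < r by near: tau; exact: nbhs_right_lt.
  have taus : s' * tau <= eta.
    rewrite mulrC -ler_pdivlMr//; apply/ltW.
    by near: tau; apply: nbhs_right_lt; rewrite divr_gt0.
  pose y' : 'rV[R]_d := \row_j (y ord0 j - tau).
  have cy' : in_cube y'.
    move=> j; rewrite mxE; have := tauy j; have /andP[? ?] := cy j => ?.
    by apply/andP; split; lra.
  have y'y j : `|y' ord0 j - y ord0 j| = tau.
    by rewrite mxE addrAC subrr add0r normrN gtr0_norm.
  have h1 : s * G y' <= s * emp_copula X n w (val u).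
    rewrite ler_pM2l//; apply: emp_copula_ge => j.
    by rewrite [X in X < _]mxE -/y; lra.
  have h2 : s * (C y - C y') <= s' * tau.
    apply: (@le_trans _ _ (s * (d%:R * tau))).
      rewrite ler_pM2l//; apply: le_trans (ler_norm _) _.
      rewrite distrC; apply: le_trans (copula_lipschitz copulaC cy' cy) _.
      by rewrite (eq_bigr (fun=> tau)) ?sumr_const ?card_ord ?mulr_natl.
    by rewrite /s' mulrDl mulrA mul1r lerDl ltW.
  have h3 : `|x (tocube y') - x (tocube y)| <= eta.
    by apply: Hr => j; rewrite !tocubeK// y'y.
  have /andP[h4 _] := ax (tocube y').
  move: h1 h3; rewrite sG// ler_norml => h1 /andP[h3 _]; lra.
have /andP[h1 h2] := ax (tocube y).
move: xyu; rewrite !ler_norml => /andP[h3 h4].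
apply/andP; split; lra.
Unshelve. all: by end_near. Qed.

End empirical_copula_expansion.

(** * The limit path and the conclusion *)

Section limit_function.
Context {R : realType} {d : nat} (C : 'rV[R]_d -> R).
Hypothesis copulaC : is_copula C.
Hypothesis null : lebesgue_outer (in_cube `\` smooth_set C) = 0%E.
Implicit Types (u v : 'rV[R]_d) (a b : 'I_d -> R -> R).
Local Notation S := (smooth_set C).

Definition gradient_dot a v : R := \sum_j partial C j v * a j (v ord0 j).

Lemma gradient_dot_dist a b v r : S v ->
  (forall j, `|a j (v ord0 j) - b j (v ord0 j)| <= r) ->
  `|gradient_dot a v - gradient_dot b v| <= d%:R * r.
Proof.
move=> Sv ab; rewrite -sumrB; apply: le_trans (ler_norm_sum _ _ _) _.
apply: (@le_trans _ _ (\sum_(j < d) r)); last by rewrite sumr_const card_ord mulr_natl.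
apply: ler_sum => j _; rewrite -mulrBr normrM; apply: le_trans (ab j).
by rewrite ler_piMl//; exact/(has_partial_lt1 copulaC)/(Sv.2 j).1.
Qed.

Lemma gradient_dot_bound a v K : S v ->
  (forall j t, 0 <= t <= 1 -> `|a j t| <= K) -> `|gradient_dot a v| <= d%:R * K.
Proof.
move=> Sv aK; have := @gradient_dot_dist a (fun _ _ => 0) v K Sv.
rewrite (_ : gradient_dot (fun _ _ => 0) v = 0) ?subr0; last first.
  by rewrite /gradient_dot big1// => j _; rewrite mulr0.
by apply => j; rewrite subr0; apply: aK; exact: Sv.1.
Qed.

Lemma coord_le_euclid v (j : 'I_d) : `|v ord0 j| <= euclid v.
Proof.
rewrite -sqrtr_sqr ler_sqrt ?sumr_ge0// => [|i _]; last exact: sqr_ge0.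
by rewrite (bigD1 j)//= lerDl sumr_ge0// => i _; exact: sqr_ge0.
Qed.

Lemma euclid_le_sum v : euclid v <= \sum_j `|v ord0 j|.
Proof.
have N0 : 0 <= \sum_j `|v ord0 j| by exact: sumr_ge0.
rewrite -(ger0_norm N0) -sqrtr_sqr ler_sqrt ?sqr_ge0//.
rewrite [leRHS]expr2 mulr_suml ler_sum// => j _.
rewrite -real_normK ?num_real// expr2 ler_wpM2l//.
by rewrite (bigD1 j)//= lerDl sumr_ge0.
Qed.

Lemma euclid_lt v e : 0 < e -> (forall j, `|v ord0 j| < e / (d%:R + 1)) ->
  euclid v < e.
Proof.
move=> e0 ve; have d1 : 0 < d%:R + 1 :> R by rewrite ltr_wpDl.
apply: le_lt_trans (euclid_le_sum _) _.
apply: (@le_lt_trans _ _ (\sum_(j < d) e / (d%:R + 1))).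
  by apply: ler_sum => j _; rewrite ltW.
rewrite sumr_const card_ord -[ltLHS]mulr_natl mulrCA gtr_pMr//.
by rewrite ltr_pdivrMr// mul1r ltrDl.
Qed.

Section bounded_direction.
Variables (a : 'I_d -> R -> R) (K : R).
Hypothesis aK : forall j t, 0 <= t <= 1 -> `|a j t| <= K.

Let close u e : set 'rV[R]_d := [set v | S v /\ euclid (v - u) < e].

Let close0 u e : in_cube u -> 0 < e -> close u e !=set0.
Proof.
move=> cu e0; have d1 : 0 < d%:R + 1 :> R by rewrite ltr_wpDl.
have [v Sv vu] := smooth_dense null cu
  (ltac:(by rewrite divr_gt0) : 0 < e / (d%:R + 1)).
exists v; split => //; apply: euclid_lt => // j; rewrite !mxE; exact: vu.
Qed.

Let bound u e v : close u e v -> `|gradient_dot a v| <= d%:R * K.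
Proof. by move=> [Sv _]; exact: gradient_dot_bound. Qed.

(** [dC] uses Euclidean distances and the topology of the cube coordinatewise ones; here and in
    [dC_lt] the neighbourhoods are converted. *)
Lemma dC_gt u c : in_cube u -> c < dC C a u -> exists2 r, 0 < r &
  forall v, S v -> (forall j, `|v ord0 j - u ord0 j| < r) -> c < gradient_dot a v.
Proof.
move=> cu /(@sup_inf_gt _ _ (close u) (gradient_dot a) _ (bound (u := u)))[e e0 He].
have d1 : 0 < d%:R + 1 :> R by rewrite ltr_wpDl.
exists (e / (d%:R + 1)); first by rewrite divr_gt0.
move=> v Sv vu; apply: He; split => //; apply: euclid_lt => // j; rewrite !mxE; exact: vu.
Qed.

Lemma dC_lt u c r : in_cube u -> dC C a u < c -> 0 < r ->
  exists2 v, S v & (forall j, `|v ord0 j - u ord0 j| < r) /\ gradient_dot a v < c.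
Proof.
move=> cu dCc r0; have := @sup_inf_lt _ _ (close u) (gradient_dot a) _
  (fun e => close0 cu) (bound (u := u)) _ _ dCc r0.
move=> [v [Sv vu] vc]; exists v => //; split => // j.
by apply: le_lt_trans vu; have := coord_le_euclid (v - u) j; rewrite !mxE.
Qed.

Lemma dC_bound u : in_cube u -> `|dC C a u| <= d%:R * K.
Proof.
move=> cu; rewrite ler_norml; apply/andP; split; rewrite leNgt; apply/negP => h.
  have [v Sv [_]] := dC_lt cu h ltr01; apply/negP; rewrite -leNgt.
  by have := gradient_dot_bound Sv aK; rewrite ler_norml => /andP[].
have [r r0 Hr] := dC_gt cu h; have [v Sv vu] := smooth_dense null cu r0.
have := Hr v Sv vu; apply/negP; rewrite -leNgt.
by have := gradient_dot_bound Sv aK; rewrite ler_norml => /andP[].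
Qed.

End bounded_direction.

Lemma dC_le a b K r u :
  (forall j t, 0 <= t <= 1 -> `|a j t| <= K) ->
  (forall j t, 0 <= t <= 1 -> `|b j t| <= K) ->
  (forall j t, 0 <= t <= 1 -> `|a j t - b j t| <= r) -> in_cube u ->
  dC C a u <= dC C b u + d%:R * r.
Proof.
move=> aK bK ab cu; rewrite leNgt; apply/negP => h.
pose c := (dC C a u + (dC C b u + d%:R * r)) / 2.
have [c1 c2] : c < dC C a u /\ dC C b u < c - d%:R * r by rewrite /c; split; lra.
have [s s0 Hs] := dC_gt aK cu c1.
have [v Sv [vu vc]] := dC_lt bK cu c2 s0.
have := @gradient_dot_dist a b v r Sv (fun j => ab j _ (Sv.1 j)).
have := Hs v Sv vu; rewrite ler_norml => ? /andP[_ ?]; lra.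
Qed.

Lemma marginN_bound (x : cube R d -> R) K : (forall u : cube R d, `|x u| <= K) ->
  forall j t, 0 <= t <= 1 -> `|- margin x j t| <= K.
Proof. by move=> xK j t _; rewrite normrN; exact: xK. Qed.

Lemma linf_limit_path x : linf x -> linf (limit_path C x).
Proof.
move=> [K xK]; exists (K + d%:R * K) => u.
apply: le_trans (ler_normD _ _) (lerD (xK u) _).
by apply: dC_bound; [exact: marginN_bound|exact: in_cubeP].
Qed.

Lemma limit_path_dist x x' r : linf x -> linf x' ->
  (forall u : cube R d, `|x u - x' u| <= r) ->
  forall u : cube R d, `|limit_path C x u - limit_path C x' u| <= r + d%:R * r.
Proof.
move=> [K xK] [K' xK'] xx' u; have cu := in_cubeP u.
have mK := marginN_bound (fun u : cube R d => le_trans (xK u) (ltac:(by rewrite le_max lexx) : K <= Num.max K K')).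
have mK' := marginN_bound (fun u : cube R d => le_trans (xK' u) (ltac:(by rewrite le_max lexx orbT) : K' <= Num.max K K')).
have h1 := @dC_le _ _ _ r _ mK mK'; have h2 := @dC_le _ _ _ r _ mK' mK.
have {}h1 := h1 (val u) _ cu; have {}h2 := h2 (val u) _ cu.
have {}h1 := h1 (ltac:(by move=> j t _; rewrite -opprD normrN; exact: xx')).
have {}h2 := h2 (ltac:(by move=> j t _; rewrite -opprD normrN distrC; exact: xx')).
rewrite /limit_path opprD addrACA; apply: le_trans (ler_normD _ _) _.
by apply: lerD => //; rewrite ler_norml; apply/andP; split; lra.
Qed.

Section continuous_path.
Variable x : cube R d -> R.
Hypothesis cx : continuous x.
Hypothesis lx : linf x.
Let f := limit_path C x.

(* Meaningful only where the partial derivatives exist: [partial] is junk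
   elsewhere. *)
Definition smooth_limit (v : cube R d) : R :=
  x v + gradient_dot (fun j t => - margin x j t) (val v).
Local Notation L := smooth_limit.

Lemma margin_unif_continuous eta : 0 < eta -> exists2 r, 0 < r &
  forall j s t, 0 <= s <= 1 -> 0 <= t <= 1 -> `|s - t| < r ->
    `|margin x j s - margin x j t| <= eta.
Proof.
move=> eta0; have [r r0 Hr] := cube_unif_continuous cx eta0.
exists r => // j s t s01 t01 st; apply: Hr => k.
have c1 : in_cube (const_mx 1 : 'rV[R]_d) by move=> i; rewrite mxE ler01 lexx.
rewrite !tocubeK; try exact: in_cube_subst.
by rewrite !mxE; case: ifP => // _; rewrite subrr normr0.
Qed.

Lemma smooth_limit_continuous (v : cube R d) eta : S (val v) -> 0 < eta ->
  exists2 r, 0 < r & forall v' : cube R d, S (val v') -> ball v r v' ->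
    `|L v' - L v| <= eta.
Proof.
move=> Sv eta0; have [K xK] := lx.
have K0 : 0 <= K by apply: le_trans (xK cube1).
(* One unit is for [x]; each coordinate costs [K] for a change of the partial derivative and 1 for a
   change of the margin, partial derivatives being at most 1. *)
pose N := 1 + d%:R * (K + 1).
have N0 : 0 < N by rewrite ltr_pwDl// mulr_ge0// addr_ge0.
pose e := eta / N; have e0 : 0 < e by rewrite divr_gt0.
have [r1 r10 H1] := smooth_partials Sv e0.
have [r2 r20 H2] := margin_unif_continuous e0.
have [r3 r30 H3] := cube_unif_continuous cx e0.
pose r := Num.min r1 (Num.min r2 r3).
have r0 : 0 < r by rewrite !lt_min r10 r20.
have [rr1 rr2 rr3] : [/\ r <= r1, r <= r2 & r <= r3].
  by rewrite /r !ge_min !lexx !orbT.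
exists r => // v' Sv' /(cube_ballE _ _ r0) vv'.
rewrite /smooth_limit opprD addrACA; apply: le_trans (ler_normD _ _) _.
have h3 : `|x v' - x v| <= e.
  by apply: H3 => j; apply: lt_le_trans (vv' j) rr3.
suff : `|gradient_dot (fun j t => - margin x j t) (val v') -
    gradient_dot (fun j t => - margin x j t) (val v)| <= d%:R * ((K + 1) * e).
  move=> h; apply: le_trans (lerD h3 h) _.
  by rewrite mulrA -{1}[e]mul1r -mulrDl -/N /e mulrC divfK// gt_eqF.
rewrite -sumrB; apply: le_trans (ler_norm_sum _ _ _) _.
apply: (@le_trans _ _ (\sum_(j < d) (K + 1) * e)); last first.
  by rewrite sumr_const card_ord mulr_natl.
apply: ler_sum => j _.
set p := partial C j (val v); set p' := partial C j (val v').
set m := margin x j _; set m' := margin x j _.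
have -> : p' * - m - p * - m' = (p - p') * m + p * (m' - m) by ring.
apply: le_trans (ler_normD _ _) _; rewrite !normrM mulrDl mul1r; apply: lerD.
  rewrite mulrC ler_pM//; first exact: xK.
  by rewrite distrC; apply: H1 => // k; exact: lt_le_trans (vv' k) rr1.
apply: (@le_trans _ _ `|m' - m|).
  by rewrite ler_piMl//; exact/(has_partial_lt1 copulaC)/(Sv.2 j).1.
apply: H2; [exact: in_cubeP|exact: in_cubeP|].
by rewrite distrC; apply: lt_le_trans (vv' j) rr2.
Qed.

(** With [limit_path_lt] this identifies [f u] as the lower limit of [L] over the smooth points near
    [u]: the continuous term [x] moves inside the supremum of infima. *)
Lemma limit_path_gt (u : cube R d) c : c < f u -> exists2 r, 0 < r &
  forall v : cube R d, S (val v) -> ball u r v -> c <= L v.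
Proof.
have [K xK] := lx; have aK := marginN_bound xK.
rewrite /f /limit_path => cf; set D := dC C _ _ in cf.
pose g := (x u + D - c) / 2; have g0 : 0 < g by rewrite divr_gt0// subr_gt0.
have cD : c - x u + g < D by rewrite /g; lra.
have [r1 r10 H1] := dC_gt aK (in_cubeP u) cD.
have [r2 r20 H2] := cube_unif_continuous cx g0.
pose r := Num.min r1 r2; have r0 : 0 < r by rewrite lt_min r10.
have [rr1 rr2] : r <= r1 /\ r <= r2 by rewrite /r !ge_min !lexx orbT.
exists r => // v Sv /(cube_ballE _ _ r0) uv.
have := H1 _ Sv (fun j => lt_le_trans (uv j) rr1).
have := H2 v u (fun j => lt_le_trans (uv j) rr2).
rewrite /smooth_limit ler_norml => /andP[? _] ?; lra.
Qed.

Lemma limit_path_lt (u : cube R d) c r : f u < c -> 0 < r ->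
  exists2 v : cube R d, S (val v) & ball u r v /\ L v < c.
Proof.
have [K xK] := lx; have aK := marginN_bound xK.
rewrite /f /limit_path => cf r0; set D := dC C _ _ in cf.
pose g := (c - (x u + D)) / 2; have g0 : 0 < g by rewrite divr_gt0// subr_gt0.
have cD : D < c - x u - g by rewrite /g; lra.
have [r2 r20 H2] := cube_unif_continuous cx g0.
pose s := Num.min r r2; have s0 : 0 < s by rewrite lt_min r0.
have [sr sr2] : s <= r /\ s <= r2 by rewrite /s !ge_min !lexx orbT.
have [v Sv [vu vc]] := dC_lt aK (in_cubeP u) cD s0.
have cv := Sv.1; exists (tocube v); first by rewrite tocubeK.
split.
  by apply/(cube_ballE _ _ r0) => j; rewrite tocubeK//; exact: lt_le_trans (vu j) sr.
have : `|x (tocube v) - x u| <= g.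
  by apply: H2 => j; rewrite tocubeK//; exact: lt_le_trans (vu j) sr2.
rewrite /smooth_limit tocubeK// ler_norml => /andP[_ ?]; lra.
Qed.

(** [L] is continuous at [v] relative to [S], so its values at nearby smooth points cannot stay
    below [L v] by a fixed amount. *)
Lemma smooth_limit_le (v : cube R d) : S (val v) -> L v <= f v.
Proof.
move=> Sv; rewrite leNgt; apply/negP => fL.
pose g := (L v - f v) / 2; have g0 : 0 < g by rewrite divr_gt0// subr_gt0.
have [r r0 Hr] := smooth_limit_continuous Sv g0.
have fg : f v < L v - g by rewrite /g; lra.
have [v' Sv' [vv' Lv']] := limit_path_lt fg r0.
have := Hr v' Sv' vv'; rewrite ler_norml => /andP[? _]; lra.
Qed.

Lemma smooth_cube_dense (u : cube R d) r : 0 < r ->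
  exists2 v : cube R d, S (val v) & ball u r v.
Proof.
move=> r0; have [v Sv vu] := smooth_dense null (in_cubeP u) r0.
have cv := Sv.1; exists (tocube v); first by rewrite tocubeK.
by apply/(cube_ballE _ _ r0) => j; rewrite tocubeK.
Qed.

(** The assumption transfers local bounds from [L] to the [g i]. For epigraphs it combines with the
    description of [f] as a lower limit of [L]. For hypographs, density of [S] and [limit_path_gt]
    supply the points to be hit, and [smooth_limit_le] turns upper bounds on [f] into upper bounds
    on [L]. *)
Lemma smooth_limit_kuratowski {I} (F : set_system I) {FF : Filter F}
    (g : I -> cube R d -> R) :
  (\forall i \near F, linf (g i)) ->
  (forall (sg : R) (u : cube R d) (r e c : R), `|sg| = 1 -> 0 < r -> 0 < e ->
     (forall v : cube R d, S (val v) -> ball u r v -> c <= sg * L v) ->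
     \forall i \near F, forall u' : cube R d, ball u (r / 2) u' -> c - e <= sg * g i u') ->
  kuratowski F (epi (lower_hull f)) (fun i => epi (lower_hull (g i))) /\
  kuratowski F (epi (lower_hull (\- f))) (fun i => epi (lower_hull (\- g i))).
Proof.
move=> lg P2; have lf : linf f by exact: linf_limit_path.
have s1 : `|1| = 1 :> R by rewrite normr1.
have sN1 : `|-1| = 1 :> R by rewrite normrN normr1.
(* At a single smooth point, [P2] with the opposite sign on a small ball gives the bound; one third
   of the gap goes to the oscillation of [L], one to the slack in [P2], and one keeps the inequality
   strict. *)
have P1 (sg : R) (v : cube R d) c : `|sg| = 1 -> S (val v) -> sg * L v < c ->
    \forall i \near F, sg * g i v < c.
  move=> sg1 Sv Lc; pose e := (c - sg * L v) / 3.
  have e0 : 0 < e by rewrite divr_gt0// subr_gt0.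
  have [r r0 Hr] := smooth_limit_continuous Sv e0.
  have H : forall v' : cube R d, S (val v') -> ball v r v' ->
      - (sg * L v) - e <= - sg * L v'.
    move=> v' Sv' vv'; have : `|sg * (L v' - L v)| <= e.
      by rewrite normrM sg1 mul1r; exact: Hr.
    by rewrite ler_norml => /andP[_ ?]; lra.
  have := P2 (- sg) v r e _ (ltac:(by rewrite normrN)) r0 e0 H.
  apply: filterS => i /(_ v (ballxx _ _)); rewrite divr_gt0// => /(_ isT).
  by rewrite /e; lra.
split; apply: epi_kuratowski => //.
- move=> u c r /(lower_hull_lt lf) H r0.
  have r20 : 0 < r / 2 by rewrite divr_gt0.
  have [u' uu' fc] := H _ r20.
  have [v Sv [u'v Lc]] := limit_path_lt fc r20.
  have := P1 1 v c s1 Sv; rewrite mul1r => /(_ Lc); apply: filterS => i.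
  by rewrite mul1r => gc; exists v => //; exact: ball_split uu' u'v.
- move=> u c cf; have {}cf := lt_le_trans cf (lower_hull_le u lf).
  pose c' := (c + f u) / 2; have [cc' c'f] : c < c' /\ c' < f u.
    by rewrite /c'; split; lra.
  have [r r0 Hr] := limit_path_gt c'f.
  exists (r / 2); first by rewrite divr_gt0.
  have H : forall v : cube R d, S (val v) -> ball u r v -> c' <= 1 * L v.
    by move=> v Sv uv; rewrite mul1r; exact: Hr.
  have := P2 1 u r (c' - c) c' s1 r0 (ltac:(by rewrite subr_gt0)) H.
  by apply: filterS => i Hi y /Hi; lra.
- exact: linfN.
- by apply: filterS lg => i; exact: linfN.
- move=> u c r /(lower_hull_lt (linfN lf)) H r0.
  have r20 : 0 < r / 2 by rewrite divr_gt0.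
  have [u' uu' /= fc] := H _ r20.
  pose c' := (f u' - c) / 2; have [cc' c'f] : - c < c' /\ c' < f u'.
    by rewrite /c'; split; lra.
  have [s s0 Hs] := limit_path_gt c'f.
  pose t := Num.min (r / 2) s; have t0 : 0 < t by rewrite lt_min r20.
  have [tr ts] : t <= r / 2 /\ t <= s by rewrite /t !ge_min !lexx orbT.
  have [v Sv u'v] := smooth_cube_dense u' t0.
  have Lv : c' <= L v by apply: Hs => //; exact: le_ball u'v.
  have := P1 (-1) v c sN1 Sv; rewrite mulN1r => /(_ (ltac:(lra))).
  apply: filterS => i; rewrite mulN1r => gc; exists v => //.
  by apply: ball_split uu' _; exact: le_ball u'v.
- move=> u c cf; pose c' := (c + lower_hull (\- f) u) / 2.
  have [cc' c'f] : c < c' /\ c' < lower_hull (\- f) u by rewrite /c'; split; lra.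
  have [e e0 He] := lower_hull_gt (linfN lf) c'f.
  exists (e / 2); first by rewrite divr_gt0.
  have H : forall v : cube R d, S (val v) -> ball u e v -> c' <= -1 * L v.
    move=> v Sv uv; have := He v uv; have := smooth_limit_le Sv => /=; lra.
  have := P2 (-1) u e (c' - c) c' sN1 e0 (ltac:(by rewrite subr_gt0)) H.
  by apply: filterS => i Hi y /Hi /=; lra.
Qed.

End continuous_path.
End limit_function.

Section dist_filter.
Context {R : realType} {I : Type} (B : R -> set I).
Hypothesis B_mono : forall s t, 0 < s -> s <= t -> B s `<=` B t.

Lemma filter_from_pos : Filter (filter_from [set t : R | 0 < t] B).
Proof.
apply: filter_from_filter; first by exists 1 => /=.
move=> s t /= s0 t0; exists (Num.min s t); first by rewrite /= lt_min s0.
have st0 : 0 < Num.min s t by rewrite lt_min s0.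
by move=> x Bx; split; apply: B_mono Bx => //; rewrite ge_min lexx ?orbT.
Qed.

End dist_filter.

Section copula_process.
Context {R : realType} {d : nat} {dsp : measure_display}
  {Om : measurableType dsp} (P : probability Om R)
  (X : nat -> {RV P >-> d.-tuple R}) (C : 'rV[R]_d -> R).
Hypothesis copulaC : is_copula C.

Lemma linf_empirical_copula_process n w : linf (empirical_copula_process X C n w).
Proof.
exists (Num.sqrt n%:R * 1) => u; rewrite /empirical_copula_process normrM.
rewrite (ger0_norm (sqrtr_ge0 _)) ler_wpM2l ?sqrtr_ge0//.
have /andP[C0 C1] := copula_itv copulaC (in_cubeP u).
have := emp_copula_ge0 X n w (val u); have := emp_copula_le1 X n w (val u).
by rewrite ler_norml => ? ?; apply/andP; split; lra.
Qed.

Section null_face.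
Hypothesis stationary : strictly_stationary X.

Lemma stationary_margin i (j : 'I_d) t :
  P [set w | tnth (X i w) j <= t] = P [set w | tnth (X 0%N w) j <= t].
Proof.
have mB : measurable [set s : 1.-tuple (d.-tuple R) | tnth (tnth s ord0) j <= t].
  rewrite -[X in measurable X]setTI.
  have := @measurable_fun_ler _ (1.-tuple (d.-tuple R)) R setT
    (fun s => tnth (tnth s ord0) j) (cst t)
    (measurableT_comp (@measurable_tnth _ _ _ j) (@measurable_tnth _ _ _ ord0))
    (@measurable_cst _ _ _ _ _ _) measurableT [set true].
  by apply.
have := stationary i mB.
rewrite (_ : [set w | _] = [set w | tnth (X i w) j <= t]); last first.
  by apply/seteqP; split => w /=; rewrite tnth_mktuple addn0.
by move=> ->; congr (P _); apply/seteqP; split => w /=; rewrite tnth_mktuple.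
Qed.

(** The zeros of the margin form a down-closed set. If it has a largest element, one null event
    suffices; otherwise the exceptional event is covered by the null events at its rational
    points. *)
Lemma marginal_df_gt0 i (j : 'I_d) :
  {ae P, forall w, 0 < marginal_df X j (tnth (X i w) j)}.
Proof.
have below0 t : marginal_df X j t <= 0 -> P.-negligible [set w | tnth (X i w) j <= t].
  move=> Ft; have := measurable_coord_le X i j t => mt.
  exists [set w | tnth (X i w) j <= t]; split => //.
  have /andP[F0 _] := marginal_df_itv X j t.
  have F00 : marginal_df X j t = 0 by apply/eqP; rewrite eq_le Ft.
  rewrite stationary_margin -[LHS]fineK; last first.
    by apply: fin_num_measure; exact: measurable_coord_le.
  by rewrite -/(marginal_df X j t) F00.
rewrite /almost_everywhere /prop_near1 /=.
have [[s [Fs smax]]|nomax] := pselect (exists s, marginal_df X j s <= 0 /\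
    forall t, marginal_df X j t <= 0 -> t <= s).
  apply: negligibleS (below0 s Fs) => w /= /negP; rewrite -leNgt; exact: smax.
pose A k := if unpickle k is Some q then
  if marginal_df X j (ratr q) <= 0 then [set w | tnth (X i w) j <= ratr q] else set0
  else set0.
apply: (@negligibleS _ _ _ P (\bigcup_k A k)).
  move=> w /= /negP; rewrite -leNgt => Fw.
  have [t [Ft wt]] : exists t, marginal_df X j t <= 0 /\ tnth (X i w) j < t.
    apply: contrapT => H; apply: nomax; exists (tnth (X i w) j); split => // t Ft.
    by rewrite leNgt; apply/negP => wt; apply: H; exists t.
  have [q] := rat_in_itvoo wt; rewrite in_itv /= => /andP[wq qt].
  exists (pickle q) => //; rewrite /A pickleK.
  by rewrite (le_trans (marginal_df_homo X j (ltW qt)) Ft) /= ltW.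
apply: negligible_bigcup => k; rewrite /A; case: (unpickle k) => [q|].
  by case: ifP => [/below0//|_]; exact: negligible_set0.
exact: negligible_set0.
Qed.

(** Through [weak_limit_eq0] this yields the condition [margin x j 0 = 0] for almost every limit
    path. *)
Lemma empirical_process_face n (j : 'I_d) :
  {ae P, forall w, empirical_process X C n w (tocube (subst_coord (const_mx 1) j 0)) = 0}.
Proof.
have : {ae P, forall w, forall i : 'I_n, 0 < marginal_df X j (tnth (X i w) j)}.
  by apply: filter_forall => i; exact: marginal_df_gt0.
apply: filterS => w Hw; have z01 : 0 <= (0 : R) <= 1 by rewrite lexx ler01.
have c1 : in_cube (const_mx 1 : 'rV[R]_d) by move=> k; rewrite mxE ler01 lexx.
rewrite /empirical_process tocubeK; last exact: in_cube_subst.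
rewrite (copula_margin copulaC j z01) emp_uniform_margin big1 ?mulr0 ?subr0 ?mulr0// => i _.
by rewrite leNgt Hw.
Qed.

End null_face.

(* "Eventually" for sample sizes [n] going to infinity jointly with empirical
   processes that approach [x] uniformly. *)
Definition process_filter (x : cube R d -> R) : set_system (nat * Om) :=
  filter_from [set t : R | 0 < t] (fun t => [set i | t^-1 <= i.1%:R /\
    sup_dist (empirical_process X C i.1 i.2) x < t]).

#[local] Instance process_filter_filter x : Filter (process_filter x).
Proof.
apply: filter_from_pos => s t s0 st i [h1 h2]; split.
  by apply: le_trans h1; rewrite lef_pV2// posrE (lt_le_trans s0 st).
exact: lt_le_trans h2 st.
Qed.

Section continuous_path.
Hypothesis null : lebesgue_outer (in_cube `\` smooth_set C) = 0%E.
Variable x : cube R d -> R.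
Hypothesis cx : continuous x.
Hypothesis lx : linf x.
Hypothesis x0 : forall j, margin x j 0 = 0.

Hypothesis lemp : forall n w, linf (empirical_process X C n w).

(** By the expansion the process is nearly [x + s * (C y - C u')], and [copula_increment] bounds the
    increment by gradient sums at nearby smooth points [v]. There [s * (y j - u' j)] is nearly
    [- margin x j] at [v j], so these sums are nearly [L v - x u']. *)
Lemma copula_process_lower (sg : R) (u : cube R d) (r e c : R) :
  `|sg| = 1 -> 0 < r -> 0 < e ->
  (forall v : cube R d, smooth_set C (val v) -> ball u r v ->
     c <= sg * smooth_limit C x v) ->
  \forall i \near process_filter x, forall u' : cube R d, ball u (r / 2) u' ->
    c - e <= sg * empirical_copula_process X C i.1 i.2 u'.
Proof.
move=> sg1 r0 e0 H.
(* The errors are [4 * eta] from the expansion, [eta] from the oscillation of [x], and in each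
   coordinate [4 * eta + eta] from the quantile and the oscillation of the margin. *)
pose eta := e / (5 * (1 + d%:R)).
have d1 : 0 < 1 + d%:R :> R by rewrite ltr_pwDl.
have eta0 : 0 < eta by rewrite divr_gt0// mulr_gt0.
have etaE : 5 * eta + d%:R * (5 * eta) = e.
  by rewrite -{1}[5 * eta]mul1r -mulrDl /eta; field; rewrite gt_eqF.
have [m Hm] := empirical_copula_expansion X copulaC cx lx x0 eta0.
have [rx rx0 Hrx] := cube_unif_continuous cx eta0.
have [rm rm0 Hrm] := margin_unif_continuous cx eta0.
have [B xB] := lx.
have B0 : 0 <= B by apply: le_trans (xB cube1).
(* The smooth points that occur lie within [2 * delta] of [u']: inside the ball of radius [r] about
   [u] and within both moduli of continuity. The bound 1/4 keeps the segment short enough for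
   [copula_increment]. *)
pose delta := Num.min (Num.min (r / 8) 4^-1) (Num.min (rx / 4) (rm / 4)).
have delta0 : 0 < delta by rewrite !lt_min !divr_gt0//= invr_gt0 ltr0n.
have dr : delta <= r / 8 by rewrite !ge_min lexx.
have d4 : delta <= 4^-1 by rewrite !ge_min lexx orbT.
have drx : delta <= rx / 4 by rewrite !ge_min lexx !orbT.
have drm : delta <= rm / 4 by rewrite !ge_min lexx !orbT.
pose K := (B + 4 * eta) / delta.
have K0 : 0 <= K by rewrite divr_ge0 ?(ltW delta0)//; lra.
pose t := Num.min eta (Num.min m.+1%:R^-1 (K ^+ 2 + 1)^-1).
have K21 : 0 < K ^+ 2 + 1 by rewrite ltr_wpDl// sqr_ge0.
have t0 : 0 < t by rewrite !lt_min eta0 !invr_gt0 K21 ltr0n.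
exists t => // -[n w] [/= tn close_n] u' uu'.
have tm : m.+1%:R <= t^-1.
  by rewrite -[m.+1%:R]invrK lef_pV2 ?posrE ?invr_gt0// !ge_min lexx !orbT.
have tK : K ^+ 2 + 1 <= t^-1.
  by rewrite -[K ^+ 2 + 1]invrK lef_pV2 ?posrE ?invr_gt0// !ge_min lexx !orbT.
have mn : (m <= n)%N by rewrite ltnW// -(ler_nat R) (le_trans tm).
have Kn : K ^+ 2 < n%:R by have := le_trans tK tn; lra.
have close_v v : `|empirical_process X C n w v - x v| < eta.
  apply: le_lt_trans (sup_dist_ub v (lemp n w) lx) _.
  by apply: lt_le_trans close_n _; rewrite ge_min lexx.
have [y cy [yu yC]] := Hm n w mn close_v u'.
set s := Num.sqrt n%:R in yu yC.
have sK : K < s.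
  by rewrite -(ger0_norm K0) -sqrtr_sqr ltr_sqrt//; apply: le_lt_trans Kn; exact: sqr_ge0.
have s0 : 0 < s by exact: le_lt_trans K0 sK.
have cu' := in_cubeP u'.
have hd j : `|y ord0 j - val u' ord0 j| <= delta.
  rewrite -(ler_pM2l s0) -{1}(gtr0_norm s0) -normrM.
  have : K * delta <= s * delta by rewrite ler_wpM2r ?(ltW delta0)// ltW.
  rewrite /K mulfVK ?gt_eqF//; apply: le_trans.
  have := yu j; set z := s * _; set b := margin _ _ _ => zb.
  have -> : z = (z + b) - b by ring.
  apply: le_trans (ler_normB _ _) _; have := xB (tocube (subst_coord (const_mx 1) j (val u' ord0 j))).
  rewrite -[x _]/b; lra.
have incr : (c - sg * x u' - eta - d%:R * (5 * eta)) / s <= sg * (C y - C (val u')).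
  apply: (copula_increment copulaC null (delta := delta)) => //.
    by move=> j; apply: le_trans (hd j) _; apply: le_trans d4 _; lra.
  move=> v Sv Hv; have cv := Sv.1.
  have vu' j : `|v ord0 j - val u' ord0 j| <= 2 * delta.
    have [q /andP[q0 q1] Hq] := Hv j.
    have -> : v ord0 j - val u' ord0 j =
      (v ord0 j - (val u' ord0 j + q * (y ord0 j - val u' ord0 j))) +
      q * (y ord0 j - val u' ord0 j) by ring.
    apply: le_trans (ler_normD _ _) _; rewrite normrM (ger0_norm q0).
    have : q * `|y ord0 j - val u' ord0 j| <= 1 * delta by rewrite ler_pM.
    lra.
  have uv : ball u r (tocube v).
    apply/(cube_ballE _ _ r0) => j; rewrite tocubeK//.
    have r20 : 0 < r / 2 by rewrite divr_gt0.
    move: uu' => /(cube_ballE _ _ r20)/(_ j); have := vu' j.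
    move=> h1 h2; rewrite -(subrKA (val u' ord0 j)).
    apply: le_lt_trans (ler_normD _ _) _; lra.
  have := H (tocube v); rewrite tocubeK// => /(_ Sv uv).
  rewrite /smooth_limit tocubeK//.
  have hx : `|sg * (x (tocube v) - x u')| <= eta.
    rewrite normrM sg1 mul1r; apply: Hrx => j; rewrite tocubeK//.
    by apply: le_lt_trans (vu' j) _; lra.
  pose b j (z : R) := s * (y ord0 j - val u' ord0 j).
  have hb : `|sg * (gradient_dot C (fun j t => - margin x j t) v - gradient_dot C b v)|
      <= d%:R * (5 * eta).
    rewrite normrM sg1 mul1r; apply: gradient_dot_dist => // j; rewrite /b.
    have h1 : `|margin x j (v ord0 j) - margin x j (val u' ord0 j)| <= eta.
      by apply: Hrm => //; apply: le_lt_trans (vu' j) _; lra.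
    rewrite (_ : _ - _ =
      - ((margin x j (v ord0 j) - margin x j (val u' ord0 j)) +
         (s * (y ord0 j - val u' ord0 j) + margin x j (val u' ord0 j)))); last by ring.
    rewrite normrN; apply: le_trans (ler_normD _ _) _; have := yu j; lra.
  have bE : gradient_dot C b v = s * \sum_j partial C j v * (y ord0 j - val u' ord0 j).
    by rewrite /gradient_dot mulr_sumr; apply: eq_bigr => j _; rewrite /b; ring.
  rewrite ler_pdivrMr//; move: hx hb; rewrite bE !ler_norml => /andP[_ hx] /andP[_ hb].
  move=> Hc; have -> : sg * (\sum_j partial C j v * (y ord0 j - val u' ord0 j)) * s =
    sg * (s * \sum_j partial C j v * (y ord0 j - val u' ord0 j)) by ring.
  lra.
move: incr; rewrite ler_pdivrMr// => incr.
have : `|sg * (empirical_copula_process X C n w u' -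
    (x u' + s * (C y - C (val u'))))| <= 4 * eta by rewrite normrM sg1 mul1r.
rewrite ler_norml => /andP[h _].
have E : sg * (s * (C y - C (val u'))) = sg * (C y - C (val u')) * s by ring.
lra.
Qed.

(** Convergence along [process_filter] is unfolded into the [delta] and [m] that
    [extended_continuous_mapping] asks for at a single path. *)
Lemma copula_process_hypi (dF : set (cube R d * R) -> set (cube R d * R) -> R) (e : R) :
  fell_metric dF -> 0 < e ->
  exists2 delta, 0 < delta & exists m, forall n w, (m <= n)%N ->
    sup_dist (empirical_process X C n w) x < delta ->
    hypi_dist dF (limit_path C x) (empirical_copula_process X C n w) < e.
Proof.
move=> dF_fell e0.
pose g (i : nat * Om) := empirical_copula_process X C i.1 i.2.
have lg : \forall i \near process_filter x, linf (g i).
  by apply: nearW => i; exact: linf_empirical_copula_process.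
have [k1 k2] := smooth_limit_kuratowski copulaC null cx lx lg copula_process_lower.
have [t /= t0 Ht] := hypi_dist_near dF_fell (linf_limit_path copulaC null lx) lg e0 k1 k2.
exists t => //.
have [m _ Hm] : \forall n \near \oo, t^-1 <= n%:R :> R by exact: nbhs_infty_ger.
by exists m => n w mn nw; apply: (Ht (n, w)); split => //; exact: Hm.
Qed.

End continuous_path.

End copula_process.

Section limit_measurable.
Context {R : realType} {d : nat} (C : 'rV[R]_d -> R).
Hypothesis copulaC : is_copula C.
Hypothesis null : lebesgue_outer (in_cube `\` smooth_set C) = 0%E.
Variable dF : set (cube R d * R) -> set (cube R d * R) -> R.
Hypothesis dF_fell : fell_metric dF.

(* Uniformly close paths have hypi-close limits, whether continuous or not, so
   the limit is Borel measurable on the whole sample space. *)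
Lemma borel_measurable_limit_path {dsp} {Om : measurableType dsp}
    (alpha : Om -> cube R d -> R) : borel_measurable linf sup_dist alpha ->
  borel_measurable (Linf dF) (Linf_dist dF)
    (fun w => hypi_class dF (limit_path C (alpha w))).
Proof.
move=> [lalpha malpha]; have ll f : linf f -> linf (limit_path C f).
  exact: linf_limit_path.
apply: borel_measurableP; first by move=> w; exists (limit_path C (alpha w)) => //; exact: ll.
move=> O [OL Oopen].
have -> : (fun w => hypi_class dF (limit_path C (alpha w))) @^-1` O =
    alpha @^-1` [set f | linf f /\ O (hypi_class dF (limit_path C f))].
  by apply/seteqP; split => [w Ow|w []].
apply: malpha; apply: sub_sigma_algebra; split; first by move=> f [].
move=> f [lf Of]; have [e e0 He] := Oopen _ Of.
pose F := filter_from [set t : R | 0 < t]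
  (fun t => [set g : cube R d -> R | linf g /\ sup_dist f g < t]).
have FF : Filter F.
  by apply: filter_from_pos => s t s0 st g [lg fg]; split => //; exact: lt_le_trans st.
have lF : \forall g \near F, linf (limit_path C g).
  by exists 1 => //= g [lg _]; exact: ll.
have H r : 0 < r -> \forall g \near F, forall u,
    `|limit_path C g u - limit_path C f u| <= r.
  move=> r0; have d1 : 0 < 1 + d%:R :> R by rewrite ltr_pwDl.
  exists (r / (1 + d%:R)) => [|g [lg fg] u] /=; first by rewrite divr_gt0.
  apply: (@le_trans _ _ (r / (1 + d%:R) + d%:R * (r / (1 + d%:R)))).
    apply: limit_path_dist => // u'; rewrite distrC.
    exact: le_trans (sup_dist_ub u' lf lg) (ltW fg).
  by rewrite -{1}[r / _]mul1r -mulrDl mulrC divfK// gt_eqF.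
have [t /= t0 Ht] := uniform_hypi_dist dF_fell (ll f lf) lF e0 H.
exists t => // g lg fg; split => //; apply: He.
  by exists (limit_path C g) => //; exact: ll.
by rewrite Linf_distE//; try exact: ll; exact: (Ht g).
Qed.

End limit_measurable.

Theorem theorem4p5 (R : realType) (d : nat) (hd : (0 < d)%N)
  (dsp : measure_display) (Om : measurableType dsp) (P : probability Om R)
  (X : nat -> {RV P >-> d.-tuple R})
  (X_stationary : strictly_stationary X)
  (F_continuous : forall j : 'I_d, continuous (marginal_df X j))
  (C : 'rV[R]_d -> R)
  (C_copula : is_copula C)
  (F_C : forall x : 'rV[R]_d,
     joint_df X x = C (\row_j marginal_df X j (x ord0 j)))
  (dsp' : measure_display) (Om' : measurableType dsp')
  (P' : probability Om' R) (alpha : Om' -> cube R d -> R)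
  (alpha_weak : weakly_converges linf sup_dist
     P (empirical_process X C) P' alpha)
  (alpha_continuous : {ae P', forall w, continuous (alpha w)})
  (S_measurable : lebesgue_outer.-caratheodory (smooth_set C))
  (S_full : lebesgue_outer (smooth_set C) = 1%E)
  (dF : set (cube R d * R) -> set (cube R d * R) -> R)
  (dF_fell : fell_metric dF) :
  weakly_converges (Linf dF) (Linf_dist dF)
    P (fun n w => hypi_class dF (empirical_copula_process X C n w))
    P' (fun w => hypi_class dF (limit_path C (alpha w))).
Proof.
have S_cube : smooth_set C `<=` in_cube by move=> v [].
have null := lebesgue_outer_cubeD hd S_cube S_measurable S_full.
have [lemp balpha _] := alpha_weak.
have blimit := borel_measurable_limit_path C_copula null dF_fell balpha.
split => // [n w|h bh].
  exists (empirical_copula_process X C n w) => //.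
  exact: linf_empirical_copula_process.
have [K hK] := bh.1.
have Lproc n w : Linf dF (hypi_class dF (empirical_copula_process X C n w)).
  exists (empirical_copula_process X C n w) => //.
  exact: linf_empirical_copula_process.
(* With the almost sure continuity, this makes almost every path admissible for
   [copula_process_hypi]. *)
have face : {ae P', forall w, forall j, margin (alpha w) j 0 = 0}.
  apply: filter_forall => j; apply: (weak_limit_eq0 alpha_weak) => n.
  exact: empirical_process_face.
have mapping := extended_continuous_mapping (@sup_dist_ge0 _ (cube R d))
  (fun f _ => sup_distxx f) (fun f g _ _ => sup_dist_sym f g)
  (@sup_dist_triangle _ (cube R d)) alpha_weak.
apply: (mapping _ _ K) => //.
- by move=> n w; apply: hK.
- by move=> w; apply: hK; exact: blimit.1.
- exact: borel_measurable_comp blimit bh.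
apply: filterS2 alpha_continuous face => w' cw' w'0 e e0.
have lw' := balpha.1 w'.
have [r r0 Hr] := bh.2 _ (blimit.1 w') e e0.
have [delta delta0 [m Hm]] :=
  copula_process_hypi C_copula null cw' lw' w'0 lemp dF_fell r0.
exists delta => //; exists m => n w mn close; apply: Hr => //.
rewrite Linf_distE//; first exact: Hm.
  exact: linf_limit_path.
exact: linf_empirical_copula_process.
Qed.
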